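(* Let $d\ge1$ be an integer. If $0<\alpha\le d+1$, then $K_\alpha,K_\alpha^+:L^1\to L^{\frac{d+1}{\alpha},\infty}$ are bounded; that is, there is a constant $C$ such that for $T=K_\alpha$ and for $T=K_\alpha^+$ one has $\|Tf\|_{L^{\frac{d+1}{\alpha},\infty}}\le C\|f\|_{L^1}$ for all $f\in L^1$.
   Context: $\mathbb{B}^d$ is the open unit ball of $\mathbb{C}^d$ with Lebesgue measure $dv$ normalized so that $v(\mathbb{B}^d)=1$; $\langle z,w\rangle=\sum_j z_j\overline{w_j}$; $L^p=L^p(\mathbb{B}^d,dv)$. For $\alpha\in\mathbb{R}$ and $f\in L^1(\mathbb{B}^d,dv)$, $$K_\alpha f(z)=\int_{\mathbb{B}^d}\frac{f(w)}{(1-\langle z,w\rangle)^\alpha}\,dv(w),\qquad K_\alpha^+f(z)=\int_{\mathbb{B}^d}\frac{f(w)}{|1-\langle z,w\rangle|^\alpha}\,dv(w),\qquad z\in\mathbb{B}^d$$ (principal branch of the power). For $r\ge1$, the Lorentz (weak $L^r$) space $L^{r,\infty}$ on $\mathbb{B}^d$ consists of measurable $f$ with $\|f\|_{L^{r,\infty}}=\sup_{\lambda>0}\lambda\, d_f(\lambda)^{1/r}<\infty$, where $d_f(\lambda)=v\{z\in\mathbb{B}^d:|f(z)|>\lambda\}$. *)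

(* Defs.v *)
(* MathComp-Analysis, with the complex numbers R[i] of mathcomp-real-closed. *)
From HB Require Import structures.
From mathcomp Require Import all_boot all_order all_algebra.
From mathcomp Require Import complex lra.
From mathcomp Require Import all_classical all_reals all_analysis.
From mathcomp Require Import measurable_realfun.
Set Implicit Arguments.
Unset Strict Implicit.
Unset Printing Implicit Defensive.
Import Order.TTheory GRing.Theory Num.Theory.
Import numFieldNormedType.Exports.
Local Open Scope classical_set_scope.
Local Open Scope ring_scope.

Section sigma_finite_lemmas.
Local Open Scope ereal_scope.
Context d1 d2 (T1 : measurableType d1) (T2 : measurableType d2) (R : realType).

Lemma sigma_finite_pushforward (m : set T1 -> \bar R) (f : T1 -> T2)
    (g : T2 -> T1) : measurable_fun setT g -> cancel f g ->
  sigma_finite setT m -> sigma_finite setT (pushforward m f).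
Proof.
move=> mg fK [F TF mF]; exists (fun n => g @^-1` F n) => [|n].
  by rewrite -preimage_bigcup -TF preimage_setT.
have [mFn Fn_fin] := mF n; split; first by rewrite -[_ @^-1` _]setTI; exact: mg.
by rewrite /pushforward -comp_preimage (_ : g \o f = id)//; apply/funext.
Qed.

(* The library's SigmaFiniteMeasure instance for [\x] is shadowed by the one
   for products of subprobabilities, hence is not inferred. *)
Lemma sigma_finite_product (m1 : {sigma_finite_measure set T1 -> \bar R})
    (m2 : {sigma_finite_measure set T2 -> \bar R}) :
  sigma_finite setT (m1 \x m2).
Proof.
have /sigma_finiteP[F [TF ndF Foo]] := sigma_finiteT m1.
have /sigma_finiteP[G [TG ndG Goo]] := sigma_finiteT m2.
exists (fun n => F n `*` G n).
  rewrite -setXTT TF TG; apply/seteqP; split => -[x y] /=.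
    move=> [[n _ Fnx] [k _ Gky]]; exists (maxn n k) => //; split.
    - by move: x Fnx; exact/subsetPset/ndF/leq_maxl.
    - by move: y Gky; exact/subsetPset/ndG/leq_maxr.
  by move=> [n _ [? ?]]; split; exists n.
move=> k; have [? ?] := Foo k; have [? ?] := Goo k.
split; first exact: measurableX.
by rewrite product_measure1E// lte_mul_pinfty// ge0_fin_numE.
Qed.

End sigma_finite_lemmas.

Section complex_measurable.
Variable R : realType.

Definition complex_to_pair (z : R[i]) : measurableTypeR R * measurableTypeR R :=
  (complex.Re z, complex.Im z).

Definition pair_to_complex (p : measurableTypeR R * measurableTypeR R) : R[i] :=
  Complex p.1 p.2.

HB.instance Definition _ := isPointed.Build R[i] 0.

(* The Borel sigma-algebra of C, transported from R * R. *)
HB.instance Definition _ := Measurable.copy R[i]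
  (g_sigma_algebra_preimageType complex_to_pair).

Lemma measurable_complex_to_pair : measurable_fun setT complex_to_pair.
Proof. by move=> _ A mA; exists A. Qed.

Lemma measurable_pair_to_complex : measurable_fun setT pair_to_complex.
Proof.
move=> _ A [B mB <-]; rewrite !setTI -comp_preimage.
by rewrite (_ : _ \o _ = id)//; apply/funext => -[].
Qed.

HB.instance Definition _ := @isMeasurableFun.Build _ _
  (measurableTypeR R * measurableTypeR R)%type R[i] pair_to_complex
  measurable_pair_to_complex.

Definition complex_lebesgue_measure : set R[i] -> \bar R :=
  pushforward (@lebesgue_measure R \x @lebesgue_measure R)%E pair_to_complex.

Let complex_lebesgue_measure0 : complex_lebesgue_measure set0 = 0%E.
Proof. exact: measure0. Qed.

Let complex_lebesgue_measure_ge0 A : (0 <= complex_lebesgue_measure A)%E.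
Proof. exact: measure_ge0. Qed.

Let complex_lebesgue_measure_sigma_additive :
  semi_sigma_additive complex_lebesgue_measure.
Proof. exact: measure_semi_sigma_additive. Qed.

HB.instance Definition _ := isMeasure.Build _ _ _ complex_lebesgue_measure
  complex_lebesgue_measure0 complex_lebesgue_measure_ge0
  complex_lebesgue_measure_sigma_additive.

Let complex_lebesgue_measure_sigma_finite :
  sigma_finite setT complex_lebesgue_measure.
Proof.
apply: (@sigma_finite_pushforward _ _ _ _ _ _ _ complex_to_pair).
- exact: measurable_complex_to_pair.
- by case.
- exact: sigma_finite_product.
Qed.

HB.instance Definition _ := Measure_isSigmaFinite.Build _ _ _
  complex_lebesgue_measure complex_lebesgue_measure_sigma_finite.

End complex_measurable.

Section tuple_measure.
Context dT (T : measurableType dT) (R : realType).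
Variable m : {sigma_finite_measure set T -> \bar R}.

Definition tuple_cons n (p : T * n.-tuple T) : n.+1.-tuple T :=
  [tuple of p.1 :: p.2].

Lemma measurable_tuple_cons n : measurable_fun setT (@tuple_cons n).
Proof. exact: (measurable_cons measurable_fst measurable_snd). Qed.

HB.instance Definition _ n := @isMeasurableFun.Build _ _
  (T * n.-tuple T)%type (n.+1.-tuple T) (@tuple_cons n)
  (@measurable_tuple_cons n).

Section tuple_measureS.
Variables (n : nat) (mn : {sigma_finite_measure set (n.-tuple T) -> \bar R}).

Definition tuple_measureS : set (n.+1.-tuple T) -> \bar R :=
  pushforward (m \x mn)%E (@tuple_cons n).

Let tuple_measureS0 : tuple_measureS set0 = 0%E.
Proof. exact: measure0. Qed.

Let tuple_measureS_ge0 A : (0 <= tuple_measureS A)%E.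
Proof. exact: measure_ge0. Qed.

Let tuple_measureS_sigma_additive : semi_sigma_additive tuple_measureS.
Proof. exact: measure_semi_sigma_additive. Qed.

HB.instance Definition _ := isMeasure.Build _ _ _ tuple_measureS
  tuple_measureS0 tuple_measureS_ge0 tuple_measureS_sigma_additive.

Let tuple_measureS_sigma_finite : sigma_finite setT tuple_measureS.
Proof.
apply: (@sigma_finite_pushforward _ _ _ _ _ _ _
  (fun t : n.+1.-tuple T => (thead t, [tuple of behead t]))).
- apply/measurable_fun_pairP; split.
  + exact: measurable_tnth.
  + exact: measurable_behead.
- by move=> [x t]; congr pair; exact/val_inj.
- exact: sigma_finite_product.
Qed.

HB.instance Definition _ := Measure_isSigmaFinite.Build _ _ _
  tuple_measureS tuple_measureS_sigma_finite.

End tuple_measureS.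

Fixpoint tuple_measure n : {sigma_finite_measure set (n.-tuple T) -> \bar R} :=
  match n with
  | 0 => \d_ [tuple]
  | n'.+1 => tuple_measureS (tuple_measure n')
  end.

End tuple_measure.

Section complex_power.
Variable R : realType.
Implicit Types w : R[i].

Definition cmod w : R := ComplexField.Normc.normc w.

(* The principal argument, with values in ]- pi, pi] for w != 0. *)
Definition carg w : R :=
  if 0 <= complex.Im w then acos (complex.Re w / cmod w)
  else - acos (complex.Re w / cmod w).

Definition clog w : R[i] := Complex (ln (cmod w)) (carg w).

Definition cexp w : R[i] :=
  Complex (expR (complex.Re w) * cos (complex.Im w))
          (expR (complex.Re w) * sin (complex.Im w)).

Definition cpow w (a : R) : R[i] := cexp (Complex a 0 * clog w).

End complex_power.

Section unit_ball.
Variables (R : realType) (d : nat).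
Implicit Types z w : d.-tuple R[i].

Definition cdot z w : R[i] := \sum_(j < d) tnth z j * conjc (tnth w j).

Definition unit_ball : set (d.-tuple R[i]) :=
  [set z | \sum_(j < d) cmod (tnth z j) ^+ 2 < 1].

Definition lebesgue_Cd : {sigma_finite_measure set (d.-tuple R[i]) -> \bar R} :=
  tuple_measure (@complex_lebesgue_measure R) d.

Lemma unit_ball_volume_inv_ge0 : 0 <= (fine (lebesgue_Cd unit_ball))^-1.
Proof. by rewrite invr_ge0 fine_ge0. Qed.

Definition dv : {measure set (d.-tuple R[i]) -> \bar R} :=
  mscale (NngNum unit_ball_volume_inv_ge0) lebesgue_Cd.

End unit_ball.
Arguments unit_ball : clear implicits.
Arguments lebesgue_Cd : clear implicits.
Arguments dv : clear implicits.

Section complex_box.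
Local Open Scope ereal_scope.
Variable R : realType.

Lemma complex_lebesgue_measure_rect (A B : set (measurableTypeR R)) :
  measurable A -> measurable B ->
  complex_lebesgue_measure [set z | A (complex.Re z) /\ B (complex.Im z)] =
  lebesgue_measure A * lebesgue_measure B.
Proof.
move=> mA mB; rewrite -product_measure1E//; exact.
Qed.

Lemma measurable_complex_rect (A B : set (measurableTypeR R)) :
  measurable A -> measurable B ->
  measurable [set z : R[i] | A (complex.Re z) /\ B (complex.Im z)].
Proof.
move=> mA mB; exists (A `*` B); first exact: measurableX.
by rewrite setTI; apply/seteqP; split => -[x y].
Qed.

End complex_box.

Section tuple_box.
Local Open Scope ereal_scope.
Context dT (T : measurableType dT) (R : realType).
Variable m : {sigma_finite_measure set T -> \bar R}.

Lemma measurable_tuple_box n (A : 'I_n -> set T) :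
  (forall i, measurable (A i)) ->
  measurable [set t : n.-tuple T | forall i, A i (tnth t i)].
Proof.
move=> mA; rewrite (_ : [set t | _] =
  \bigcap_(i in [set: 'I_n]) (@tnth n T ^~ i) @^-1` A i).
  apply: fin_bigcap_measurable => // i _.
  by rewrite -[X in measurable X]setTI; exact: measurable_tnth.
by apply/seteqP; split => t /= tA i => [_|]; exact: tA.
Qed.

Lemma tuple_measure_box n (A : 'I_n -> set T) : (forall i, measurable (A i)) ->
  tuple_measure m n [set t | forall i, A i (tnth t i)] = \prod_(i < n) m (A i).
Proof.
elim: n A => [|n IHn] A mA.
  by rewrite big_ord0 /= diracE mem_set// => -[].
rewrite big_ord_recl -(IHn (fun i => A (lift ord0 i)))// -product_measure1E//;
  last first.
  exact: (measurable_tuple_box (fun i => mA (lift ord0 i))).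
congr (product_measure1 _ _ _); apply/seteqP; split => -[x t] /= H.
- split; first exact: (H ord0).
  by move=> i; have := H (lift ord0 i); rewrite tnthS.
- by move: H => [H0 H1] i; case: (unliftP ord0 i) => [j|] ->//; rewrite tnthS.
Qed.

End tuple_box.

Section unit_ball_volume.
Variables (R : realType) (d : nat).

Lemma measurable_Re : measurable_fun setT (@complex.Re R : R[i] -> R).
Proof.
exact: (measurableT_comp measurable_fst (@measurable_complex_to_pair R)).
Qed.

Lemma measurable_Im : measurable_fun setT (@complex.Im R : R[i] -> R).
Proof.
exact: (measurableT_comp measurable_snd (@measurable_complex_to_pair R)).
Qed.

Lemma sqr_cmod (w : R[i]) :
  cmod w ^+ 2 = complex.Re w ^+ 2 + complex.Im w ^+ 2.
Proof. by case: w => a b; rewrite /cmod/= sqr_sqrtr// addr_ge0// sqr_ge0. Qed.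

Lemma measurable_unit_ball : measurable (unit_ball R d).
Proof.
pose q (z : d.-tuple R[i]) : R :=
  \sum_(j < d) (complex.Re (tnth z j) ^+ 2 + complex.Im (tnth z j) ^+ 2).
have mq : measurable_fun setT q.
  apply: measurable_sum => j; have mj := @measurable_tnth _ R[i] d j.
  apply: measurable_funD; apply: measurable_funX.
  - exact: (measurableT_comp measurable_Re mj).
  - exact: (measurableT_comp measurable_Im mj).
rewrite (_ : unit_ball R d = setT `&` q @^-1` `]-oo, 1[%classic).
  by apply: mq => //; exact: measurable_itv.
have qE z : q z = \sum_(j < d) cmod (tnth z j) ^+ 2.
  by apply: eq_bigr => j _; rewrite sqr_cmod.
by rewrite setTI; apply/seteqP; split => z /=; rewrite in_itv/= qE.
Qed.

Let rect (I : interval R) : set R[i] :=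
  [set w | [set` I] (complex.Re w) /\ [set` I] (complex.Im w)].

Let box (I : interval R) : set (d.-tuple R[i]) :=
  [set t | forall j, rect I (tnth t j)].

Let mrect I : measurable (rect I).
Proof. by apply: measurable_complex_rect; exact: measurable_itv. Qed.

Let mbox I : measurable (box I).
Proof. exact: (measurable_tuple_box (fun=> mrect I)). Qed.

Let vol_box I : lebesgue_Cd R d (box I) =
  (\prod_(j < d) (lebesgue_measure [set` I] * lebesgue_measure [set` I]))%E.
Proof.
rewrite [LHS](tuple_measure_box _ (fun=> mrect I)).
apply: eq_bigr => j _.
by apply: complex_lebesgue_measure_rect; exact: measurable_itv.
Qed.

Let vol_box_itv (a b : R) : a < b ->
  lebesgue_Cd R d (box `[a, b]) = (((b - a) ^+ 2) ^+ d)%:E.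
Proof.
move=> ab; rewrite vol_box.
under eq_bigr do rewrite !lebesgue_measure_itv/= !lte_fin ab -!EFinD -EFinM.
by rewrite prodEFin prodr_const card_ord expr2.
Qed.

Lemma lebesgue_Cd_unit_ball_fin_num :
  lebesgue_Cd R d (unit_ball R d) \is a fin_num.
Proof.
rewrite ge0_fin_numE//.
apply: (@le_lt_trans _ _ (lebesgue_Cd R d (box `[-1, 1]))); last first.
  by rewrite vol_box_itv ?ltrN10 ?ltry//; lra.
apply: le_measure; rewrite ?inE; [exact: measurable_unit_ball|exact: mbox|].
move=> z /= zB j; rewrite /rect/= !in_itv/= -!ler_norml.
have : cmod (tnth z j) ^+ 2 <= 1.
  apply: le_trans (ltW zB); rewrite (bigD1 j)//= lerDl.
  by apply: sumr_ge0 => k _; exact: sqr_ge0.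
rewrite sqr_cmod; move: (complex.Re _) (complex.Im _) => a b ab1.
by split; rewrite ler_norml; apply/andP; split; nra.
Qed.

Lemma lebesgue_Cd_unit_ball_gt0 : (0 < lebesgue_Cd R d (unit_ball R d))%E.
Proof.
pose e : R := (2 * (d%:R + 1))^-1.
have d0 : 0 <= d%:R :> R by exact: ler0n.
have e0 : 0 < e by rewrite invr_gt0; lra.
have de : d%:R * (e ^+ 2 + e ^+ 2) < 1.
  have eE : e * (2 * (d%:R + 1)) = 1 by rewrite /e mulVf// gt_eqF//; lra.
  by nra.
apply: (@lt_le_trans _ _ (lebesgue_Cd R d (box `[- e, e]))).
  by rewrite vol_box_itv ?lte_fin; [rewrite !exprn_gt0//; lra|lra].
apply: le_measure; rewrite ?inE; [exact: mbox|exact: measurable_unit_ball|].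
move=> z /= zB; apply: le_lt_trans de.
rewrite mulr_natl -[in leRHS](card_ord d) -sumr_const.
apply: ler_sum => j _; rewrite sqr_cmod; have [] := zB j.
rewrite /rect/= !in_itv/= => /andP[a1 a2] /andP[b1 b2].
by apply: lerD; nra.
Qed.

Lemma dv_unit_ball : dv R d (unit_ball R d) = 1%E.
Proof.
rewrite /dv /= /mscale/= -[X in (_ * X)%E]fineK ?lebesgue_Cd_unit_ball_fin_num//.
rewrite -EFinM mulVf// fine_eq0 ?lebesgue_Cd_unit_ball_fin_num//.
by rewrite gt_eqF// lebesgue_Cd_unit_ball_gt0.
Qed.

End unit_ball_volume.

Section operators.
Variables (R : realType) (d : nat).
Implicit Types (f g : d.-tuple R[i] -> R[i]) (z : d.-tuple R[i]).

Definition cintegral f : R[i] :=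
  Complex (\int[dv R d]_(w in unit_ball R d) complex.Re (f w))%R
          (\int[dv R d]_(w in unit_ball R d) complex.Im (f w))%R.

Definition Kop (alpha : R) f z : R[i] :=
  cintegral (fun w => f w / cpow (1 - cdot z w) alpha).

Definition Kop_plus (alpha : R) f z : R[i] :=
  cintegral (fun w => f w / Complex (cmod (1 - cdot z w) `^ alpha) 0).

Local Open Scope ereal_scope.

Definition L1norm f : \bar R :=
  \int[dv R d]_(w in unit_ball R d) (cmod (f w))%:E.

(* Borel representatives: L1norm, Kop and Kop_plus only depend on the class of
   f modulo almost everywhere equality on the ball. *)
Definition L1 : set (d.-tuple R[i] -> R[i]) :=
  [set f | measurable_fun (unit_ball R d) f /\ L1norm f < +oo].

Definition distr_fun g (lambda : R) : \bar R :=
  dv R d [set z | unit_ball R d z /\ (lambda < cmod (g z))%R].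

Definition weak_norm (r : R) g : \bar R :=
  ereal_sup [set lambda%:E * distr_fun g lambda `^ r^-1
            | lambda in [set lambda : R | (0 < lambda)%R]].

Definition weak_L (r : R) : set (d.-tuple R[i] -> R[i]) :=
  [set g | measurable_fun (unit_ball R d) g /\ weak_norm r g < +oo].

Definition bounded_L1_weak (r : R)
    (T : (d.-tuple R[i] -> R[i]) -> d.-tuple R[i] -> R[i]) (C : R) :=
  forall f, L1 f -> weak_L r (T f) /\ weak_norm r (T f) <= C%:E * L1norm f.

End operators.
Arguments bounded_L1_weak {R d}.
Arguments Kop {R} d.
Arguments Kop_plus {R} d.

(* Main.v *)
Require Import Defs.
From mathcomp Require Import all_boot all_order all_algebra.
From mathcomp Require Import complex ring lra.
From mathcomp Require Import all_classical all_reals all_analysis.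
From mathcomp Require Import measurable_realfun.
Set Implicit Arguments.
Unset Strict Implicit.
Unset Printing Implicit Defensive.
Import Order.TTheory GRing.Theory Num.Theory.
Import numFieldNormedType.Exports.
Local Open Scope classical_set_scope.
Local Open Scope ring_scope.

(* Write q(z,w) = |1 - <z,w>|.  It is a quasi-metric with nonzero
   self-distances, 1 - |z|^2 <= 2 q(z,w), and the q-ball of radius s has volume
   O(s^(d+1)), even O(s^d t) after intersection with {1 - |u|^2 < t}.  Both
   operators are dominated by the positive kernel q^(-alpha), and L^1 functions
   may be replaced by finite sums of point masses m_i at w_i, since on
   {1 - |z|^2 >= delta} the kernel is almost constant on small cells.

   For alpha < d+1, the integral of q(w,.)^(-alpha) over E is
   O(v(E)^(1 - alpha/(d+1))), which gives the weak bound by Chebyshev's inequality.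

   For alpha = d+1 one argues as in the Calderon-Zygmund decomposition.  At each
   w_i take an almost maximal radius sigma_i for which the q-ball has mass at
   least lambda sigma_i^(d+1); by a Vitali selection, the union of these balls has
   volume O(|m|/lambda).  Off that union the masses can be moved radially to
   points p_i at depth comparable to max(sigma_i, 1 - |w_i|^2); the moved measure
   is a Carleson measure of size O(lambda), so that it behaves like a density
   bounded by O(lambda), and a Schur test with the weight (1 - |z|^2)^(-1/2),
   i.e. the Forelli-Rudin estimate, controls its potential. *)

(** * Geometry of the ball *)

(** At alpha = d+1 each dyadic shell about w, between the depth of w and unit size, contributes
    about the same amount to the integral of the kernel, so Chebyshev's inequality alone would lose
    a logarithm. The kernel is positive, hence there is no cancellation to gain from subtracting
    averages. Moving a mass from w_i to p_i is instead justified by comparison: off the exceptional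
    set q(p_i,z) <= 15 q(w_i,z), so the move costs a constant factor and needs no regularity of the
    kernel. The potential of a bounded density is not bounded either (again a logarithm), but q(z,z)
    = 1 - |z|^2 cuts off the singularity at the depth of z, and the power -1/2 of the depth is
    reproduced by the kernel up to a constant. This weight is singular at the sphere, which is why
    volumes are needed with the extra factor t of the thin direction. With finitely many masses the
    selection of balls is a finite greedy argument; the constants do not depend on their number, so
    the partition can be as fine as desired. The dimension is written [n.+1], hence d+1 reads
    [n.+2]. *)

Section cmod_lemmas.
Variable R : realType.
Implicit Types (x y : R[i]) (a : R).

Lemma cmod_ge0 x : 0 <= cmod x.
Proof. by case: x => a b; exact: sqrtr_ge0. Qed.

Lemma cmod0 : cmod (0 : R[i]) = 0. Proof. exact: ComplexField.Normc.normc0. Qed.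

Lemma cmodM x y : cmod (x * y) = cmod x * cmod y.
Proof. exact: ComplexField.Normc.normcM. Qed.

Lemma cmodV x : cmod x^-1 = (cmod x)^-1.
Proof. exact: ComplexField.Normc.normcV. Qed.

Lemma cmodN x : cmod (- x) = cmod x.
Proof. exact: (@complex.normcN R). Qed.

Lemma cmodD x y : cmod (x + y) <= cmod x + cmod y.
Proof. exact: (@complex.le_normcD R). Qed.

Lemma cmodB x y : cmod (x - y) = cmod (y - x).
Proof. by rewrite -cmodN opprB. Qed.

Lemma cmodJ x : cmod (conjc x) = cmod x.
Proof. by case: x => a b; rewrite /cmod/= sqrrN. Qed.

Lemma cmod_real a : cmod (Complex a 0) = `|a|.
Proof. by rewrite /cmod/= expr0n/= addr0 sqrtr_sqr. Qed.

Lemma cmod_eq0 x : (cmod x == 0) = (x == 0).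
Proof.
apply/eqP/eqP => [|->]; last exact: cmod0.
exact: ComplexField.Normc.eq0_normc.
Qed.

Lemma Re_le_cmod x : `|complex.Re x| <= cmod x.
Proof.
by rewrite -(ler_pXn2r (ltn0Sn 1)) ?nnegrE ?cmod_ge0// real_normK ?num_real//
  sqr_cmod lerDl sqr_ge0.
Qed.

Lemma Im_le_cmod x : `|complex.Im x| <= cmod x.
Proof.
by rewrite -(ler_pXn2r (ltn0Sn 1)) ?nnegrE ?cmod_ge0// real_normK ?num_real//
  sqr_cmod lerDr sqr_ge0.
Qed.

Lemma cmod_le_ReIm x : cmod x <= `|complex.Re x| + `|complex.Im x|.
Proof.
rewrite -(ler_pXn2r (ltn0Sn 1)) ?nnegrE ?cmod_ge0 ?addr_ge0//.
rewrite sqr_cmod -(real_normK (num_real (complex.Re x))).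
rewrite -(real_normK (num_real (complex.Im x))).
have := normr_ge0 (complex.Re x); have := normr_ge0 (complex.Im x).
nra.
Qed.

Lemma cmod_sum (I : Type) (r : seq I) (P : pred I) (F : I -> R[i]) :
  cmod (\sum_(i <- r | P i) F i) <= \sum_(i <- r | P i) cmod (F i).
Proof.
elim/big_ind2 : _ => [|x a y b xa yb|//]; first by rewrite cmod0.
by rewrite (le_trans (cmodD _ _))// lerD.
Qed.

Lemma ReD x y : complex.Re (x + y) = complex.Re x + complex.Re y.
Proof. by case: x; case: y. Qed.

Lemma ReB x y : complex.Re (x - y) = complex.Re x - complex.Re y.
Proof. by case: x; case: y. Qed.

Lemma ImB x y : complex.Im (x - y) = complex.Im x - complex.Im y.
Proof. by case: x; case: y. Qed.

Lemma Re_sum (I : Type) (r : seq I) (P : pred I) (F : I -> R[i]) :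
  complex.Re (\sum_(i <- r | P i) F i) = \sum_(i <- r | P i) complex.Re (F i).
Proof. by apply: big_morph => //; exact: ReD. Qed.

Lemma Im_sum (I : Type) (r : seq I) (P : pred I) (F : I -> R[i]) :
  complex.Im (\sum_(i <- r | P i) F i) = \sum_(i <- r | P i) complex.Im (F i).
Proof. by apply: big_morph => // -[? ?] []. Qed.

End cmod_lemmas.

Section ball_geometry.
Variables (R : realType) (d : nat).
Implicit Types z w u : d.-tuple R[i].

Definition defect z : R := 1 - \sum_(j < d) cmod (tnth z j) ^+ 2.

Definition qdist z w : R := cmod (1 - cdot z w).

Definition sqdist z w : R := \sum_(j < d) cmod (tnth z j - tnth w j) ^+ 2.

Lemma unit_ballE z : unit_ball R d z <-> 0 < defect z.
Proof. by rewrite /defect subr_gt0. Qed.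

Lemma defect_le1 z : defect z <= 1.
Proof. by rewrite gerBl sumr_ge0// => j _; rewrite sqr_ge0. Qed.

Lemma sqdist_ge0 z w : 0 <= sqdist z w.
Proof. by rewrite sumr_ge0// => j _; rewrite sqr_ge0. Qed.

Lemma qdist_ge0 z w : 0 <= qdist z w. Proof. exact: cmod_ge0. Qed.

Lemma sqr_cmod_le_sum z j : cmod (tnth z j) ^+ 2 <= 1 - defect z.
Proof.
rewrite /defect opprB addrC subrK (bigD1 j)//= lerDl.
by rewrite sumr_ge0// => k _; exact: sqr_ge0.
Qed.

Lemma sqr_cmod_le_sqdist z w j : cmod (tnth z j - tnth w j) ^+ 2 <= sqdist z w.
Proof.
rewrite /sqdist (bigD1 j)//= lerDl.
by rewrite sumr_ge0// => k _; exact: sqr_ge0.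
Qed.

Lemma cmod_le1 z j : unit_ball R d z -> cmod (tnth z j) <= 1.
Proof.
move=> /unit_ballE z0; rewrite -(ler_pXn2r (ltn0Sn 1)) ?nnegrE ?cmod_ge0//.
by rewrite expr1n (le_trans (sqr_cmod_le_sum z j))// gerBl ltW.
Qed.

Lemma cdotJ z w : conjc (cdot z w) = cdot w z.
Proof.
rewrite /cdot rmorph_sum; apply: eq_bigr => j _.
by rewrite rmorphM/= conjcK mulrC.
Qed.

Lemma qdistC z w : qdist z w = qdist w z.
Proof. by rewrite /qdist -cmodJ rmorphB rmorph1/= cdotJ. Qed.

(** Polarization. This identity is the source of all lower bounds on q: inside the ball its three
    terms are nonnegative, so q dominates both depths and the squared Euclidean distance. *)
Lemma Re_cdot z w : 2 * complex.Re (1 - cdot z w) =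
  defect z + defect w + sqdist z w.
Proof.
rewrite ReB/= Re_sum /defect /sqdist.
rewrite [RHS](_ : _ = 2 - \sum_(j < d) (cmod (tnth z j) ^+ 2 +
  cmod (tnth w j) ^+ 2 - cmod (tnth z j - tnth w j) ^+ 2)); last first.
  by rewrite !big_split/= sumrN; lra.
rewrite mulrBr mulr1 mulr_sumr; congr (_ - _); apply: eq_bigr => j _.
rewrite !sqr_cmod ReB ImB; case: (tnth z j) => a b; case: (tnth w j) => e f /=.
by lra.
Qed.

Lemma defect_qdist z w : defect z + defect w + sqdist z w <= 2 * qdist z w.
Proof.
rewrite -Re_cdot ler_pM2l//; exact: le_trans (ler_norm _) (Re_le_cmod _).
Qed.

Lemma defect_le_qdist z w : unit_ball R d w -> defect z <= 2 * qdist z w.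
Proof.
move=> /unit_ballE w0; apply: le_trans (defect_qdist z w).
by have := sqdist_ge0 z w; lra.
Qed.

Lemma sqdist_le_qdist z w : unit_ball R d z -> unit_ball R d w ->
  sqdist z w <= 2 * qdist z w.
Proof.
move=> /unit_ballE z0 /unit_ballE w0; apply: le_trans (defect_qdist z w).
by lra.
Qed.

Lemma qdist_gt0 z w : unit_ball R d z -> unit_ball R d w -> 0 < qdist z w.
Proof.
move=> /unit_ballE z0 Bw; have := defect_le_qdist z Bw; lra.
Qed.

Lemma cdot_self z : cdot z z = Complex (1 - defect z) 0.
Proof.
rewrite /defect opprB addrC subrK /cdot.
apply/eqP; rewrite eq_complex/= Re_sum Im_sum; apply/andP; split; apply/eqP.
  by apply: eq_bigr => j _; rewrite sqr_cmod; case: (tnth z j) => a b /=; ring.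
by rewrite big1// => j _; case: (tnth z j) => a b /=; ring.
Qed.

Lemma onem_cdot_self z : 1 - cdot z z = Complex (defect z) 0.
Proof.
by rewrite cdot_self; apply/eqP; rewrite eq_complex/= subr0 eqxx andbT; apply/eqP; ring.
Qed.

(* With [a = qdist z u], [b = qdist u w], expand
   [1 - <z,w> = (1 - <z,u>) + (1 - <u,w>) - (1 - |u|^2) + <z-u,u-w>]
   and bound the last term by [(|z-u|^2 + |u-w|^2) / 2 <= a + b]. *)
Lemma qdist_triangle u z w :
  unit_ball R d z -> unit_ball R d u -> unit_ball R d w ->
  qdist z w <= 3 * (qdist z u + qdist u w).
Proof.
move=> Bz Bu Bw.
pose e := \sum_(j < d) (tnth z j - tnth u j) * conjc (tnth u j - tnth w j).
have E : 1 - cdot z w =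
    (1 - cdot z u) + (1 - cdot u w) - Complex (defect u) 0 + e.
  have -> : e = cdot z u - cdot z w - cdot u u + cdot u w.
    rewrite /e /cdot -!sumrN -!big_split/=; apply: eq_bigr => j _.
    by rewrite rmorphB/=; ring.
  by rewrite -onem_cdot_self; ring.
have ele : cmod e <= qdist z u + qdist u w.
  have /= H1 := sqdist_le_qdist Bz Bu; have /= H2 := sqdist_le_qdist Bu Bw.
  apply: (@le_trans _ _ ((sqdist z u + sqdist u w) / 2)); last by lra.
  apply: le_trans (cmod_sum _ _ _) _.
  rewrite /sqdist -big_split/= mulr_suml; apply: ler_sum => j _.
  rewrite cmodM cmodJ ler_pdivlMr//.
  by have := sqr_ge0 (cmod (tnth z j - tnth u j) - cmod (tnth u j - tnth w j)); nra.
have du : cmod (Complex (defect u) 0) <= qdist z u + qdist u w.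
  move/unit_ballE : (Bu) => u0; rewrite cmod_real (ger0_norm (ltW u0)).
  by have := defect_le_qdist u Bw; have := defect_le_qdist u Bz; rewrite (qdistC u z); lra.
rewrite {1}/qdist E.
apply: le_trans (cmodD _ _) _.
have := cmodD (1 - cdot z u + (1 - cdot u w)) (- Complex (defect u) 0).
have := cmodD (1 - cdot z u) (1 - cdot u w).
rewrite cmodN -/(qdist z u) -/(qdist u w); lra.
Qed.

(** Serves the discretization: a small Euclidean displacement of the source is negligible against q
    once q is bounded below by the depth of z. *)
Lemma qdist_lip z w w' : unit_ball R d z ->
  qdist z w <= qdist z w' + \sum_(j < d) cmod (tnth w j - tnth w' j).
Proof.
move=> Bz; rewrite /qdist.
have -> : 1 - cdot z w = (1 - cdot z w') +
    \sum_(j < d) tnth z j * conjc (tnth w' j - tnth w j).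
  rewrite (_ : \sum_(j < d) _ = cdot z w' - cdot z w); first by ring.
  by rewrite /cdot -sumrN -big_split; apply: eq_bigr => j _; rewrite rmorphB/=; ring.
apply: le_trans (cmodD _ _) _; rewrite lerD2l.
apply: le_trans (cmod_sum _ _ _) _; apply: ler_sum => j _.
by rewrite cmodM cmodJ cmodB ler_piMl ?cmod_ge0// cmod_le1.
Qed.

End ball_geometry.

(** * Measures of slices *)

Section product_slices.
Local Open Scope ereal_scope.
Context d1 d2 (T1 : measurableType d1) (T2 : measurableType d2) (R : realType).
Variable m1 : {sigma_finite_measure set T1 -> \bar R}.
Variable m2 : {sigma_finite_measure set T2 -> \bar R}.
Variable A : set (T1 * T2).
Hypothesis mA : measurable A.

Lemma product_measure_swap : (m1 \x m2) A = \int[m2]_y m1 (ysection A y).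
Proof.
transitivity ((m1 \x^ m2) A) => //.
by apply: product_measure_unique => //= *; rewrite product_measure2E.
Qed.

Variable c : R.
Hypothesis c0 : (0 <= c)%R.

Lemma product_measure_le_x (X : set T1) : measurable X ->
  (forall p, A p -> X p.1) -> (forall x, m2 (xsection A x) <= c%:E) ->
  (m1 \x m2) A <= c%:E * m1 X.
Proof.
move=> mX AX Ac; rewrite -integral_cst// integral_mkcond.
apply: ge0_le_integral => //=.
- exact: measurable_fun_xsection.
- apply/(measurable_restrictT _ _).1 => //; exact: measurable_cst.
- move=> x _; rewrite patchE; case: ifPn => // xX.
  rewrite (_ : xsection _ _ = set0) ?measure0//; apply/seteqP; split => // y.
  by rewrite /xsection/= inE => /AX/= ?; move: xX; rewrite notin_setE.
Qed.

Lemma product_measure_le_y (Y : set T2) : measurable Y ->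
  (forall p, A p -> Y p.2) -> (forall y, m1 (ysection A y) <= c%:E) ->
  (m1 \x m2) A <= c%:E * m2 Y.
Proof.
move=> mY AY Ac; rewrite product_measure_swap -integral_cst// integral_mkcond.
apply: ge0_le_integral => //=.
- exact: measurable_fun_ysection.
- apply/(measurable_restrictT _ _).1 => //; exact: measurable_cst.
- move=> y _; rewrite patchE; case: ifPn => // yY.
  rewrite (_ : ysection _ _ = set0) ?measure0//; apply/seteqP; split => // x.
  by rewrite /ysection/= inE => /AY/= ?; move: yY; rewrite notin_setE.
Qed.

Lemma product_measure_ge_x (X : set T1) : measurable X ->
  (forall x, X x -> c%:E <= m2 (xsection A x)) ->
  c%:E * m1 X <= (m1 \x m2) A.
Proof.
move=> mX Ac; rewrite -integral_cst// integral_mkcond.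
apply: ge0_le_integral => //=.
- by move=> x _; rewrite patchE; case: ifP.
- apply/(measurable_restrictT _ _).1 => //; exact: measurable_cst.
- exact: measurable_fun_xsection.
- by move=> x _; rewrite patchE; case: ifPn => xX; [exact/Ac/set_mem|exact: measure_ge0].
Qed.

Lemma product_measure_ge_y (Y : set T2) : measurable Y ->
  (forall y, Y y -> c%:E <= m1 (ysection A y)) ->
  c%:E * m2 Y <= (m1 \x m2) A.
Proof.
move=> mY Ac; rewrite product_measure_swap -integral_cst// integral_mkcond.
apply: ge0_le_integral => //=.
- by move=> x _; rewrite patchE; case: ifP.
- apply/(measurable_restrictT _ _).1 => //; exact: measurable_cst.
- exact: measurable_fun_ysection.
- by move=> y _; rewrite patchE; case: ifPn => xX; [exact/Ac/set_mem|exact: measure_ge0].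
Qed.

End product_slices.

Section tuple_slices.
Local Open Scope ereal_scope.
Context dT (T : measurableType dT) (R : realType).
Variable m : {sigma_finite_measure set T -> \bar R}.

Definition tuple_set n (j : 'I_n) (t : n.-tuple T) (x : T) : n.-tuple T :=
  [tuple if i == j then x else tnth t i | i < n].

Lemma tuple_set0 n (t : n.-tuple T) x y :
  tuple_set ord0 (tuple_cons (y, t)) x = tuple_cons (x, t).
Proof.
apply: eq_from_tnth => i; rewrite tnth_mktuple.
by case: (unliftP ord0 i) => [k|] ->//; rewrite !tnthS.
Qed.

Lemma tuple_setS n (j : 'I_n) (t : n.-tuple T) x y :
  tuple_set (lift ord0 j) (tuple_cons (y, t)) x = tuple_cons (y, tuple_set j t x).
Proof.
apply: eq_from_tnth => i; rewrite tnth_mktuple.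
case: (unliftP ord0 i) => [k|] ->//.
by rewrite !tnthS tnth_mktuple (inj_eq (@lift_inj _ _)).
Qed.

Let measurable_cons_preimage n (A : set (n.+1.-tuple T)) : measurable A ->
  measurable (@tuple_cons _ T n @^-1` A).
Proof.
by move=> mA; rewrite -[X in measurable X]setTI; exact: measurable_tuple_cons.
Qed.

Lemma tuple_measureSE n (A : set (n.+1.-tuple T)) :
  tuple_measure m n.+1 A =
  (m \x tuple_measure m n) (@tuple_cons _ T n @^-1` A).
Proof. by []. Qed.

(** Fubini with one distinguished coordinate, measured by its slices, while the others only range
    over a box. The distinguished coordinate will be one on which the point is not small, so it
    cannot be fixed in advance; the induction peels off coordinates until it comes first. *)
Lemma tuple_measure_slice_le n (j : 'I_n.+1) (A : set (n.+1.-tuple T))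
    (X : 'I_n.+1 -> set T) (b c : R) :
  measurable A -> (forall i, measurable (X i)) -> (forall i, m (X i) = b%:E) ->
  (forall t, A t -> forall i, i != j -> X i (tnth t i)) ->
  (forall t, m [set x | A (tuple_set j t x)] <= c%:E) ->
  tuple_measure m n.+1 A <= (c * b ^+ n)%:E.
Proof.
elim: n j A X => [|n IHn] j A X mA mX Xb AX Ac.
all: have := mA => /measurable_cons_preimage mA'; rewrite tuple_measureSE.
all: case: (unliftP ord0 j) => [j'|] jE.
- by case: j' jE.
- rewrite expr0 mulr1 -[c%:E]mule1.
  rewrite -[X in _ * X](_ : tuple_measure m 0 setT = 1); last exact: diracT.
  apply: (product_measure_le_y _ mA') => // t.
  (* [point] is a dummy: [tuple_set] overwrites that coordinate. *)
  rewrite (_ : ysection _ _ =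
    [set x | A (tuple_set j (tuple_cons (point, t)) x)])//.
  by apply/seteqP; split => x; rewrite /ysection/= jE tuple_set0 inE.
- rewrite exprSr mulrA EFinM -(Xb ord0).
  apply: (product_measure_le_x _ mA').
  + exact: mX.
  + by move=> [x t] /= /AX /(_ ord0); apply; rewrite jE.
  + move=> x; apply: (IHn j' _ (fun i => X (lift ord0 i))) => //.
    * exact: measurable_xsection.
    * move=> t; rewrite /xsection/= inE/= => /AX + i ij => /(_ (lift ord0 i)).
      by rewrite tnthS; apply; rewrite jE (inj_eq (@lift_inj _ _)).
    * move=> t; apply: le_trans (Ac (tuple_cons (x, t))).
      rewrite (_ : [set _ | _] = [set y | A (tuple_set j (tuple_cons (x, t)) y)])//.
      by apply/seteqP; split => y; rewrite /xsection/= jE tuple_setS inE.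
- rewrite EFinM (_ : (b ^+ _)%:E = tuple_measure m n.+1
      [set t | forall i, X (lift ord0 i) (tnth t i)]); last first.
    rewrite (tuple_measure_box m (fun i => mX (lift ord0 i))).
    rewrite (eq_bigr (fun=> b%:E)) => [|i _]; last exact: Xb.
    by rewrite prodEFin prodr_const card_ord.
  apply: (product_measure_le_y _ mA').
  + exact: (measurable_tuple_box (fun i => mX (lift ord0 i))).
  + move=> [x t] /= At i; have := AX _ At (lift ord0 i); rewrite tnthS; apply.
    by rewrite jE.
  + move=> t; rewrite (_ : ysection _ _ =
      [set x | A (tuple_set j (tuple_cons (point, t)) x)])//.
    by apply/seteqP; split => x; rewrite /ysection/= jE tuple_set0 inE.
Qed.

Lemma tuple_measure_slice_ge n (j : 'I_n.+1) (A : set (n.+1.-tuple T))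
    (X : 'I_n.+1 -> set T) (b c : R) : (0 <= b)%R -> (0 <= c)%R ->
  measurable A -> (forall i, measurable (X i)) -> (forall i, m (X i) = b%:E) ->
  (forall t, (forall i, i != j -> X i (tnth t i)) ->
    c%:E <= m [set x | A (tuple_set j t x)]) ->
  (c * b ^+ n)%:E <= tuple_measure m n.+1 A.
Proof.
move=> b0 c0; elim: n j A X => [|n IHn] j A X mA mX Xb Ac.
all: have := mA => /measurable_cons_preimage mA'; rewrite tuple_measureSE.
all: case: (unliftP ord0 j) => [j'|] jE.
- by case: j' jE.
- rewrite expr0 mulr1 -[c%:E]mule1.
  rewrite -[X in _ * X](_ : tuple_measure m 0 setT = 1); last exact: diracT.
  apply: (product_measure_ge_y _ mA') => // t _.
  rewrite (_ : ysection _ _ =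
    [set x | A (tuple_set j (tuple_cons (point, t)) x)]); last first.
    by apply/seteqP; split => x; rewrite /ysection/= jE tuple_set0 inE.
  by apply: Ac => i; rewrite jE (ord1 i) eqxx.
- rewrite exprSr mulrA EFinM -(Xb ord0).
  apply: (product_measure_ge_x _ mA'); first by rewrite mulr_ge0// exprn_ge0.
  + exact: mX.
  + move=> x Xx; apply: (IHn j' _ (fun i => X (lift ord0 i))) => //.
    * exact: measurable_xsection.
    * move=> t Xt; apply: (@le_trans _ _ (m
        [set y | A (tuple_set j (tuple_cons (x, t)) y)])); last first.
        rewrite (_ : [set _ | _] =
          [set y | xsection (@tuple_cons _ T n.+1 @^-1` A) x (tuple_set j' t y)])//.
        by apply/seteqP; split => y; rewrite /xsection/= jE tuple_setS inE.
      apply: Ac => i; case: (unliftP ord0 i) => [k|] -> //.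
      by rewrite jE (inj_eq (@lift_inj _ _)) tnthS => /Xt.
- rewrite EFinM (_ : (b ^+ _)%:E = tuple_measure m n.+1
      [set t | forall i, X (lift ord0 i) (tnth t i)]); last first.
    rewrite (tuple_measure_box m (fun i => mX (lift ord0 i))).
    rewrite (eq_bigr (fun=> b%:E)) => [|i _]; last exact: Xb.
    by rewrite prodEFin prodr_const card_ord.
  apply: (product_measure_ge_y _ mA') => //.
    exact: (measurable_tuple_box (fun i => mX (lift ord0 i))).
  move=> t Xt; rewrite (_ : ysection _ _ =
      [set x | A (tuple_set j (tuple_cons (point, t)) x)]); last first.
    by apply/seteqP; split => x; rewrite /ysection/= jE tuple_set0 inE.
  apply: Ac => i; case: (unliftP ord0 i) => [k|] ->; last by rewrite jE eqxx.
  by rewrite tnthS => _; exact: Xt.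
Qed.

End tuple_slices.

Section planar_measure.
Variable R : realType.

Lemma lebesgue_measure_le_diam (S : set (measurableTypeR R)) (L : R) :
  measurable S -> 0 <= L -> (forall x y, S x -> S y -> `|x - y| <= L) ->
  (lebesgue_measure S <= (L *+ 2)%:E)%E.
Proof.
move=> mS L0 SL; have [->|/set0P[x0 Sx0]] := eqVneq S set0.
  by rewrite measure0 lee_fin mulrn_wge0.
apply: (@le_trans _ _ (lebesgue_measure `[x0 - L, x0 + L]%classic)).
  apply: le_measure; rewrite ?inE// => x Sx; rewrite /= in_itv/=.
  by rewrite -ler_distlC SL.
rewrite lebesgue_measure_itv/= lte_fin; case: ifP => _; last first.
  by rewrite lee_fin mulrn_wge0.
by rewrite -EFinD lee_fin mulr2n; lra.
Qed.

Let measurable_pair_preimage (S : set R[i]) : measurable S ->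
  measurable (@pair_to_complex R @^-1` S).
Proof.
by move=> mS; rewrite -[X in measurable X]setTI; exact: measurable_pair_to_complex.
Qed.

(** The bound [b] is asked only along horizontal slices; a curved piece of a thin annulus satisfies
    this with [b] of the order of its width. Each factor 2 comes from centring an interval at an
    arbitrary point of the set. *)
Lemma complex_measure_le_diam_Re (S : set R[i]) (a b : R) :
  measurable S -> 0 <= a -> 0 <= b ->
  (forall p q, S p -> S q -> `|complex.Im p - complex.Im q| <= a) ->
  (forall p q, S p -> S q -> complex.Im p = complex.Im q ->
    `|complex.Re p - complex.Re q| <= b) ->
  (complex_lebesgue_measure S <= (b *+ 2 * (a *+ 2))%:E)%E.
Proof.
move=> mS a0 b0 Sa Sb; have [->|/set0P[p0 Sp0]] := eqVneq S set0.
  by rewrite measure0 lee_fin mulr_ge0// mulrn_wge0.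
pose Y : set (measurableTypeR R) := `[complex.Im p0 - a, complex.Im p0 + a]%classic.
have mY : measurable Y by exact: measurable_itv.
apply: (@le_trans _ _ ((b *+ 2)%:E * lebesgue_measure Y)%E).
  apply: (@product_measure_le_y _ _ _ _ _ _ _ _ (measurable_pair_preimage mS)).
  - exact: mY.
  - by move=> [x y] /= Sxy; rewrite /Y/= in_itv/= -ler_distlC; exact: (Sa p0 (Complex x y)).
  - move=> y; apply: lebesgue_measure_le_diam => //.
      exact: (measurable_ysection y (measurable_pair_preimage mS)).
    move=> x x'; rewrite /ysection/= !inE => Sx Sx'.
    exact: (Sb (Complex x y) (Complex x' y)).
rewrite EFinM; apply: lee_wpmul2l; first by rewrite lee_fin mulrn_wge0.
rewrite /Y lebesgue_measure_itv/= lte_fin; case: ifP => _; last first.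
  by rewrite lee_fin mulrn_wge0.
by rewrite -EFinD lee_fin mulr2n; lra.
Qed.

Lemma complex_measure_le_diam_Im (S : set R[i]) (a b : R) :
  measurable S -> 0 <= a -> 0 <= b ->
  (forall p q, S p -> S q -> `|complex.Re p - complex.Re q| <= a) ->
  (forall p q, S p -> S q -> complex.Re p = complex.Re q ->
    `|complex.Im p - complex.Im q| <= b) ->
  (complex_lebesgue_measure S <= (b *+ 2 * (a *+ 2))%:E)%E.
Proof.
move=> mS a0 b0 Sa Sb; have [->|/set0P[p0 Sp0]] := eqVneq S set0.
  by rewrite measure0 lee_fin mulr_ge0// mulrn_wge0.
pose Y : set (measurableTypeR R) := `[complex.Re p0 - a, complex.Re p0 + a]%classic.
have mY : measurable Y by exact: measurable_itv.
apply: (@le_trans _ _ ((b *+ 2)%:E * lebesgue_measure Y)%E).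
  apply: (@product_measure_le_x _ _ _ _ _ _ _ _ (measurable_pair_preimage mS)).
  - exact: mY.
  - by move=> [x y] /= Sxy; rewrite /Y/= in_itv/= -ler_distlC; exact: (Sa p0 (Complex x y)).
  - move=> x; apply: lebesgue_measure_le_diam => //.
      exact: (measurable_xsection x (measurable_pair_preimage mS)).
    move=> y y'; rewrite /xsection/= !inE => Sy Sy'.
    exact: (Sb (Complex x y) (Complex x y')).
rewrite EFinM; apply: lee_wpmul2l; first by rewrite lee_fin mulrn_wge0.
rewrite /Y lebesgue_measure_itv/= lte_fin; case: ifP => _; last first.
  by rewrite lee_fin mulrn_wge0.
by rewrite -EFinD lee_fin mulr2n; lra.
Qed.

Definition csquare (c : R[i]) (r : R) : set R[i] :=
  [set x | `[complex.Re c - r, complex.Re c + r]%classic (complex.Re x) /\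
           `[complex.Im c - r, complex.Im c + r]%classic (complex.Im x)].

Lemma csquareP (c x : R[i]) r : csquare c r x <->
  `|complex.Re x - complex.Re c| <= r /\ `|complex.Im x - complex.Im c| <= r.
Proof.
by rewrite /csquare/= !in_itv/= -!ler_distlC -![`|complex.Re x - _|]distrC
  -![`|complex.Im x - _|]distrC.
Qed.

Lemma measurable_csquare c r : measurable (csquare c r).
Proof. by apply: measurable_complex_rect; exact: measurable_itv. Qed.

Lemma complex_measure_csquare c r : 0 <= r ->
  complex_lebesgue_measure (csquare c r) = ((r *+ 2) ^+ 2)%:E.
Proof.
move=> r0; rewrite complex_lebesgue_measure_rect; try exact: measurable_itv.
rewrite !lebesgue_measure_itv/= !lte_fin.
have [->|r_neq0] := eqVneq r 0.
  by rewrite !subr0 !addr0 !ltxx mul0e mul0rn expr0n.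
have rp : 0 < r by rewrite lt_def r_neq0.
have lt a : a - r < a + r by lra.
rewrite !lt.
by rewrite -!EFinD -EFinM; congr EFin; ring.
Qed.

End planar_measure.

(** * Integration over dyadic shells *)

Section dyadic_shells.
Variable R : realType.
Implicit Types x r : R.

Let exists_expn2_gt x : exists j, x < 2 ^+ j.
Proof.
have [x0|x0] := leP x 0; first by exists 0%N; rewrite expr0; lra.
exists (Num.bound x); apply: lt_trans (archi_boundP (ltW x0)) _.
by rewrite -natrX ltr_nat ltn_expl.
Qed.

Lemma dyadic_shell_up r x : 0 < r -> r <= x ->
  exists j, r * 2 ^+ j <= x < 2 * (r * 2 ^+ j).
Proof.
move=> r0 rx; have [j0 Hj0] := exists_expn2_gt (x / r).
have ex : exists j, x < 2 * (r * 2 ^+ j).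
  exists j0; move: Hj0; rewrite ltr_pdivrMr// => /lt_le_trans; apply.
  have : 0 < 2 ^+ j0 :> R by rewrite exprn_gt0.
  by move: (2 ^+ j0) => y; nra.
case: (ex_minnP ex) => -[|j] xj minj; first by exists 0%N; rewrite xj mulr1 rx.
exists j.+1; rewrite xj andbT exprS mulrCA leNgt; apply/negP => /minj.
by rewrite ltnn.
Qed.

Lemma dyadic_shell_down r x : 0 < x -> x < 2 * r ->
  exists j, r * 2^-1 ^+ j <= x < 2 * (r * 2^-1 ^+ j).
Proof.
move=> x0 xr; have [j0 Hj0] := exists_expn2_gt (r / x).
have ex : exists j, r * 2^-1 ^+ j <= x.
  exists j0; move: Hj0; rewrite ltr_pdivrMr// exprVn ler_pdivrMr ?exprn_gt0//.
  by move=> /ltW; rewrite mulrC.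
case: (ex_minnP ex) => -[|j] xj minj.
  by exists 0%N; rewrite xj expr0 mulr1.
exists j.+1; rewrite xj/= exprS mulrCA mulVKf// ltNge; apply/negP => /minj.
by rewrite ltnn.
Qed.

Lemma nneseries_geometric_le (c y : R) : 0 <= c -> 0 < y -> y < 1 ->
  (\sum_(0 <= j <oo) (c * y ^+ j)%:E <= (c / (1 - y))%:E)%E.
Proof.
move=> c0 y0 y1; apply: lime_le.
  by apply: is_cvg_nneseries => n _ _; rewrite lee_fin mulr_ge0// exprn_ge0// ltW.
apply: nearW => n; rewrite sumEFin lee_fin.
by have := @geometric_le_lim R n c y c0 y0; rewrite seriesEnat gtr0_norm//; apply.
Qed.

End dyadic_shells.

Section shell_integral.
Local Open Scope ereal_scope.
Context dT (T : measurableType dT) (R : realType).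
Variable mu : {measure set T -> \bar R}.

(* The shells [r0 * th ^+ j <= q < 2 * (r0 * th ^+ j)] cover [D]; th is 1/2 or 2
   according to whether [q] or its inverse is to be integrated to the end. *)
Lemma shell_integral_le (D : set T) (h q : T -> R) (a b A r0 th : R) :
  measurable D -> measurable_fun setT h -> measurable_fun setT q ->
  (forall x, 0 <= h x)%R ->
  (0 < r0)%R -> (0 < th)%R -> (0 <= A)%R -> (0 <= a)%R ->
  (th `^ (b - a) < 1)%R ->
  (forall r, (0 < r)%R ->
    \int[mu]_(x in D `&` [set x | (q x < r)%R]) (h x)%:E <= (A * r `^ b)%:E) ->
  (forall x, D x -> exists j, (r0 * th ^+ j <= q x < 2 * (r0 * th ^+ j))%R) ->
  \int[mu]_(x in D) (h x * q x `^ (- a))%:E <=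
    (A * 2 `^ b * r0 `^ (b - a) / (1 - th `^ (b - a)))%:E.
Proof.
move=> mD mh mq h0 r00 th0 A0 a0 th1 Hq cov.
pose r j : R := (r0 * th ^+ j)%R.
have rp j : (0 < r j)%R by rewrite mulr_gt0// exprn_gt0.
pose E j := [set x | (q x < 2 * r j)%R].
have mE j : measurable (E j).
  rewrite (_ : E j = setT `&` q @^-1` `]-oo, (2 * r j)%R[%classic).
    by apply: mq => //; exact: measurable_itv.
  by rewrite setTI; apply/seteqP; split => x /=; rewrite in_itv.
pose G j x : \bar R := (r j `^ (- a))%:E * ((EFin \o h) \_ (E j)) x.
have mG j : measurable_fun D (G j).
  apply: emeasurable_funM => //.
  apply: (@measurable_funS _ _ _ _ setT) => //.
  by apply/(measurable_restrictT _ _).1 => //; exact/measurable_EFinP/measurable_funTS.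
have G0 j x : 0 <= G j x.
  rewrite mule_ge0 ?lee_fin ?powR_ge0// patchE; case: ifP => //= _.
  by rewrite lee_fin.
have mF : measurable_fun D (fun x => (h x * q x `^ (- a))%:E).
  apply/measurable_EFinP; apply: (@measurable_funS _ _ _ _ setT) => //.
  by apply: measurable_funM => //; exact: (measurableT_comp (measurable_powR _)).
apply: (@le_trans _ _ (\int[mu]_(x in D) \sum_(0 <= j <oo) G j x)).
  apply: ge0_le_integral => //.
  - by move=> x _; rewrite lee_fin mulr_ge0// powR_ge0.
  - exact: (@ge0_emeasurable_sum _ _ _ _ _ xpredT).
  - move=> x Dx; have [j /andP[jq qj]] := cov _ Dx.
    apply: (@le_trans _ _ (G j x)); last first.
      apply: le_trans (nneseries_lim_ge j.+1 (fun n _ _ => G0 n x)).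
      rewrite big_nat_recr//= leeDr// sume_ge0// => i _; exact: G0.
    rewrite /G patchE ifT; last by rewrite inE.
    rewrite /= -EFinM lee_fin mulrC ler_wpM2r//.
    rewrite !powRN lef_pV2 ?posrE ?powR_gt0//; last exact: (lt_le_trans (rp j) jq).
    by apply: ge0_ler_powR => //; rewrite nnegrE ltW//; exact: (lt_le_trans (rp j) jq).
rewrite integral_nneseries//.
apply: le_trans (nneseries_geometric_le _ _ th1); last 2 first.
- by rewrite !mulr_ge0 ?powR_ge0.
- exact: powR_gt0.
apply: lee_nneseries => [j _ _|j _]; first by apply: integral_ge0 => x _.
rewrite ge0_integralZl//; last 3 first.
- apply: (@measurable_funS _ _ _ _ setT) => //.
  by apply/(measurable_restrictT _ _).1 => //; exact/measurable_EFinP/measurable_funTS.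
- by move=> x _; rewrite patchE; case: ifP => //= _; rewrite lee_fin.
- by rewrite lee_fin powR_ge0.
rewrite -integral_mkcondr.
apply: (@le_trans _ _ ((r j `^ (- a))%:E * (A * (2 * r j) `^ b)%:E)).
  apply: lee_wpmul2l; first by rewrite lee_fin powR_ge0.
  by apply: Hq; rewrite mulr_gt0.
rewrite -EFinM lee_fin powRM//; last exact: ltW.
have -> : ((th `^ (b - a)) ^+ j = (th ^+ j) `^ (b - a))%R.
  by rewrite -powR_mulrn ?powR_ge0// -powR_mulrn ?ltW// powRAC.
have eM : (r0 `^ (b - a) * (th ^+ j) `^ (b - a) = r j `^ (- a) * r j `^ b)%R.
  rewrite -powRM ?exprn_ge0 ?ltW// -/(r j) addrC powRD//.
  by rewrite (gt_eqF (rp j)) implybT.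
by rewrite -[leRHS]mulrA eM le_eqVlt; apply/orP; left; apply/eqP; ring.
Qed.

End shell_integral.

(** * Volumes and kernel integrals in the ball *)

Lemma measure_le_sum dT (T : measurableType dT) (R : realType)
    (mu : {measure set T -> \bar R}) (I : finType) (F : I -> set T) (A : set T) :
  measurable A -> (forall i, measurable (F i)) ->
  (forall x, A x -> exists i, F i x) -> (mu A <= \sum_i mu (F i))%E.
Proof.
move=> mA mF AF.
have mU (s : seq I) : measurable (\big[setU/set0]_(i <- s) F i).
  by apply: bigsetU_measurable => i _; exact: mF.
apply: (@le_trans _ _ (mu (\big[setU/set0]_i F i))).
  apply: le_measure; rewrite ?inE// => x /AF[i Fix].
  by rewrite (bigD1 i)//=; left.
elim: (index_enum I) => [|i s IHs]; first by rewrite !big_nil measure0.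
by rewrite !big_cons; apply: le_trans (measureU2 _ _ _) _ => //; exact: leeD.
Qed.

Section ball_measurability.
Variable R : realType.

Lemma measurable_cmod : measurable_fun setT (@cmod R : R[i] -> R).
Proof.
have -> : @cmod R = fun w => (complex.Re w ^+ 2 + complex.Im w ^+ 2) `^ 2^-1.
  apply/funext => w; rewrite powR12_sqrt ?addr_ge0 ?sqr_ge0// -sqr_cmod.
  by rewrite sqrtr_sqr ger0_norm// cmod_ge0.
apply: (measurableT_comp (measurable_powR _)).
by apply: measurable_funD; apply: measurable_funX;
  [exact: measurable_Re|exact: measurable_Im].
Qed.

Lemma measurable_ReIm dT (T : measurableType dT) (f : T -> R[i]) :
  measurable_fun setT (@complex.Re R \o f) ->
  measurable_fun setT (@complex.Im R \o f) -> measurable_fun setT f.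
Proof.
move=> mr mi.
have -> : f = @pair_to_complex R \o (fun x => (complex.Re (f x), complex.Im (f x))).
  by apply/funext => x /=; rewrite /pair_to_complex/=; case: (f x).
apply: (measurableT_comp (@measurable_pair_to_complex R)).
exact: measurable_fun_pair.
Qed.

Variable d : nat.
Notation V := (d.-tuple R[i]).

Lemma measurable_cdot : measurable_fun setT (fun p : V * V => cdot p.1 p.2).
Proof.
have m1 (j : 'I_d) : measurable_fun setT (fun p : V * V => tnth p.1 j).
  exact: (measurableT_comp (@measurable_tnth _ R[i] d j) measurable_fst).
have m2 (j : 'I_d) : measurable_fun setT (fun p : V * V => tnth p.2 j).
  exact: (measurableT_comp (@measurable_tnth _ R[i] d j) measurable_snd).
have mRe1 j := measurableT_comp (@measurable_Re R) (m1 j).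
have mRe2 j := measurableT_comp (@measurable_Re R) (m2 j).
have mIm1 j := measurableT_comp (@measurable_Im R) (m1 j).
have mIm2 j := measurableT_comp (@measurable_Im R) (m2 j).
apply: measurable_ReIm.
- rewrite (_ : _ \o _ = fun p : V * V => \sum_(j < d)
    (complex.Re (tnth p.1 j) * complex.Re (tnth p.2 j) +
     complex.Im (tnth p.1 j) * complex.Im (tnth p.2 j))).
    by apply: measurable_sum => j; apply: measurable_funD;
      [exact: (measurable_funM (mRe1 j) (mRe2 j))|exact: (measurable_funM (mIm1 j) (mIm2 j))].
  apply/funext => p; rewrite /= /cdot Re_sum; apply: eq_bigr => j _.
  by case: (tnth p.1 j) => a b; case: (tnth p.2 j) => e f /=; ring.
- rewrite (_ : _ \o _ = fun p : V * V => \sum_(j < d)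
    (complex.Im (tnth p.1 j) * complex.Re (tnth p.2 j) -
     complex.Re (tnth p.1 j) * complex.Im (tnth p.2 j))).
    by apply: measurable_sum => j; apply: measurable_funB;
      [exact: (measurable_funM (mIm1 j) (mRe2 j))|exact: (measurable_funM (mRe1 j) (mIm2 j))].
  apply/funext => p; rewrite /= /cdot Im_sum; apply: eq_bigr => j _.
  by case: (tnth p.1 j) => a b; case: (tnth p.2 j) => e f /=; ring.
Qed.

Lemma measurable_onem_cdot :
  measurable_fun setT (fun p : V * V => 1 - cdot p.1 p.2).
Proof.
have m := measurable_cdot; apply: measurable_ReIm.
- rewrite (_ : _ \o _ = fun p : V * V => 1 - complex.Re (cdot p.1 p.2)).
    by apply: measurable_funB => //; exact: (measurableT_comp (@measurable_Re R) m).
  by apply/funext => p; rewrite /= ReB.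
- rewrite (_ : _ \o _ = fun p : V * V => 0 - complex.Im (cdot p.1 p.2)).
    by apply: measurable_funB => //; exact: (measurableT_comp (@measurable_Im R) m).
  by apply/funext => p; rewrite /= ImB.
Qed.

Lemma measurable_qdist_pair : measurable_fun setT (fun p : V * V => qdist p.1 p.2).
Proof. exact: (measurableT_comp measurable_cmod measurable_onem_cdot). Qed.

Lemma measurable_qdist z : measurable_fun setT (@qdist R d z).
Proof. exact: (measurableT_comp measurable_qdist_pair (pair1_measurable z)). Qed.

Lemma measurable_defect : measurable_fun setT (@defect R d).
Proof.
apply: measurable_funB => //; apply: measurable_sum => j.
apply: measurable_funX.
exact: (measurableT_comp measurable_cmod (@measurable_tnth _ R[i] d j)).
Qed.

Lemma measurable_lt (f : V -> R) (r : R) : measurable_fun setT f ->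
  measurable [set x | f x < r].
Proof.
move=> mf; rewrite (_ : [set _ | _] = setT `&` f @^-1` `]-oo, r[%classic).
  by apply: mf => //; exact: measurable_itv.
by rewrite setTI; apply/seteqP; split => x /=; rewrite in_itv.
Qed.

Lemma measurable_ge (f : V -> R) (r : R) : measurable_fun setT f ->
  measurable [set x | r <= f x].
Proof.
move=> mf; rewrite (_ : [set _ | _] = setT `&` f @^-1` `[r, +oo[%classic).
  by apply: mf => //; exact: measurable_itv.
by rewrite setTI; apply/seteqP; split => x /=; rewrite in_itv/= andbT.
Qed.

Lemma measurable_tuple_set (j : 'I_d) (t : V) (A : set V) : measurable A ->
  measurable [set x | A (tuple_set j t x)].
Proof.
move=> mA; rewrite -[X in measurable X]setTI.
suff : measurable_fun setT (tuple_set j t) by apply.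
apply/measurable_fun_tnthP => i.
have [->|ij] := eqVneq i j.
  rewrite (_ : _ \o _ = id); first exact: measurable_id.
  by apply/funext => x; rewrite /= tnth_mktuple eqxx.
rewrite (_ : _ \o _ = cst (tnth t i)); first exact: measurable_cst.
by apply/funext => x; rewrite /= tnth_mktuple (negbTE ij).
Qed.

End ball_measurability.

Section strip.
Variable R : realType.

(** One of the four numbers Re x, - Re x, Im x, - Im x. Fixing which one is large keeps two points
    on the same side of the axis, so that their coordinates add up instead of cancelling. *)
Definition signed_coord (b1 b2 : bool) (x : R[i]) : R :=
  (-1) ^+ b2 * (if b1 then complex.Re x else complex.Im x).

Lemma signed_coord_le_cmod b1 b2 x : signed_coord b1 b2 x <= cmod x.
Proof.
rewrite /signed_coord; apply: le_trans (ler_norm _) _.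
by rewrite normrM normr_sign mul1r; case: b1; rewrite ?Re_le_cmod ?Im_le_cmod.
Qed.

Lemma measurable_signed_coord b1 b2 : measurable_fun setT (signed_coord b1 b2).
Proof.
apply: measurable_funM => //.
by case: b1; [exact: measurable_Re|exact: measurable_Im].
Qed.

Lemma exists_signed_coord_ge (x : R[i]) (c : R) : 0 <= c ->
  2 * c ^+ 2 <= cmod x ^+ 2 -> exists b1 b2, c <= signed_coord b1 b2 x.
Proof.
move=> c0; rewrite sqr_cmod => H.
have [b1 Hb1] : exists b1 : bool,
    c ^+ 2 <= (if b1 then complex.Re x else complex.Im x) ^+ 2.
  have [H1|H1] := leP (c ^+ 2) (complex.Re x ^+ 2); first by exists true.
  by exists false; lra.
exists b1; rewrite /signed_coord; move: (if b1 then _ else _) Hb1 => y Hy.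
have [y0|y0] := leP 0 y.
  by exists false; rewrite expr0 mul1r; nra.
by exists true; rewrite expr1 mulN1r; nra.
Qed.

(** Along the axis chosen by [b1], with the other coordinate fixed, |p|^2 - |q|^2 = (x - y)(x + y)
    with |x + y| >= 2c, so the slices have diameter at most t / (2c); across that axis the diameter
    [a] is used. *)
Lemma annulus_piece_measure_le (S : set R[i]) b1 b2 (a c t : R) :
  measurable S -> 0 < c -> 0 <= a -> 0 <= t ->
  (forall p, S p -> c <= signed_coord b1 b2 p) ->
  (forall p q, S p -> S q -> cmod (p - q) <= a) ->
  (forall p q, S p -> S q -> cmod p ^+ 2 - cmod q ^+ 2 <= t) ->
  (complex_lebesgue_measure S <= (2 / c * (a * t))%:E)%E.
Proof.
move=> mS c0 a0 t0 Sc Sa St.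
have -> : 2 / c * (a * t) = (t / (2 * c)) *+ 2 * (a *+ 2).
  by rewrite !mulr2n; field; rewrite gt_eqF.
have key x y : c <= (-1) ^+ b2 * x -> c <= (-1) ^+ b2 * y ->
    x ^+ 2 - y ^+ 2 <= t -> y ^+ 2 - x ^+ 2 <= t -> `|x - y| <= t / (2 * c).
  move=> cx cy xy yx; rewrite ler_pdivlMr ?mulr_gt0//.
  move: cx cy; case: b2 {Sc}; rewrite ?expr0 ?expr1 ?mul1r ?mulN1r => cx cy;
    by have [?|?] := ger0P (x - y); nra.
case: b1 Sc => Sc.
- apply: complex_measure_le_diam_Re => //.
  + by rewrite divr_ge0// mulr_ge0// ltW.
  + by move=> p q Sp Sq; rewrite -ImB; apply: le_trans (Im_le_cmod _) (Sa _ _ Sp Sq).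
  + move=> p q Sp Sq E; apply: key; [exact: Sc|exact: Sc| |].
    * by have := St _ _ Sp Sq; rewrite !sqr_cmod E; lra.
    * by have := St _ _ Sq Sp; rewrite !sqr_cmod E; lra.
- apply: complex_measure_le_diam_Im => //.
  + by rewrite divr_ge0// mulr_ge0// ltW.
  + by move=> p q Sp Sq; rewrite -ReB; apply: le_trans (Re_le_cmod _) (Sa _ _ Sp Sq).
  + move=> p q Sp Sq E; apply: key; [exact: Sc|exact: Sc| |].
    * by have := St _ _ Sp Sq; rewrite !sqr_cmod E; lra.
    * by have := St _ _ Sq Sp; rewrite !sqr_cmod E; lra.
Qed.

Variable n : nat.
Notation V := (n.+1.-tuple R[i]).
Notation B := (unit_ball R n.+1).
Notation L := (lebesgue_Cd R n.+1).

Definition strip (z : V) (s t : R) : set V :=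
  B `&` [set u | qdist z u < s] `&` [set u | defect u < t].

Lemma measurable_strip z s t : measurable (strip z s t).
Proof.
apply: measurableI; first apply: measurableI.
- exact: measurable_unit_ball.
- by apply: measurable_lt; exact: measurable_qdist.
- by apply: measurable_lt; exact: measurable_defect.
Qed.

Lemma defect_tuple_set (j : 'I_n.+1) (u : V) p : defect (tuple_set j u p) =
  1 - \sum_(i < n.+1 | i != j) cmod (tnth u i) ^+ 2 - cmod p ^+ 2.
Proof.
rewrite /defect (bigD1 j)//= tnth_mktuple eqxx opprD addrA addrAC; congr (_ - _ - _).
by apply: eq_bigr => i ij; rewrite tnth_mktuple (negbTE ij).
Qed.

Lemma cdot_tuple_set (z u : V) (j : 'I_n.+1) p : cdot z (tuple_set j u p) =
  tnth z j * conjc p + \sum_(i < n.+1 | i != j) tnth z i * conjc (tnth u i).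
Proof.
rewrite /cdot (bigD1 j)//= tnth_mktuple eqxx; congr (_ + _).
by apply: eq_bigr => i ij; rewrite tnth_mktuple (negbTE ij).
Qed.

(** Coordinates other than [j] stay in squares of area 8s, because |u - z|^2 <= 2s. With these
    fixed, the j-th coordinate lies in an annulus on which |u_j|^2 varies by at most t, and in a set
    of diameter O(s), because 1 - <z,u> depends on it through z_j times its conjugate. *)
Lemma strip_piece_measure_le (z : V) (s t c : R) (j : 'I_n.+1) b1 b2 :
  B z -> 0 < s -> 0 < t -> 0 < c -> c <= 2^-1 ->
  (L (strip z s t `&` [set u | (c <= signed_coord b1 b2 (tnth u j))%R]) <=
   (2 / c * (16 / c ^+ 2 * s * t) * (8 * s) ^+ n)%:E)%E.
Proof.
move=> Bz s0 t0 c0 c1; set A := _ `&` _.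
have mA : measurable A.
  apply: measurableI; first exact: measurable_strip.
  apply: (measurable_ge c (f := signed_coord b1 b2 \o (fun u : V => tnth u j))).
  exact: (measurableT_comp (measurable_signed_coord _ _) (@measurable_tnth _ R[i] n.+1 j)).
have sqs u : strip z s t u -> sqdist u z <= 2 * s.
  move=> [[Bu /= us] _]; apply: le_trans (sqdist_le_qdist Bu Bz) _.
  by rewrite qdistC ler_pM2l// ltW.
pose X (i : 'I_n.+1) := csquare (tnth z i) (Num.sqrt (2 * s)).
have s20 : 0 <= 2 * s by lra.
apply: (@tuple_measure_slice_le _ _ _ _ n j A X) => //.
- by move=> i; exact: measurable_csquare.
- move=> i; rewrite [LHS]complex_measure_csquare ?sqrtr_ge0//.
  have sE := sqr_sqrtr s20; congr EFin.
  rewrite (_ : _ ^+ 2 = 4 * Num.sqrt (2 * s) ^+ 2); last by rewrite mulr2n; ring.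
  by rewrite sE; ring.
- move=> u [Su _] i _; have := sqs _ Su => H.
  have {}H : cmod (tnth u i - tnth z i) <= Num.sqrt (2 * s).
    rewrite -(ler_pXn2r (ltn0Sn 1)) ?nnegrE ?cmod_ge0 ?sqrtr_ge0// sqr_sqrtr//.
    exact: le_trans (sqr_cmod_le_sqdist _ _ _) H.
  apply/csquareP; rewrite -ReB -ImB.
  by split; [exact: le_trans (Re_le_cmod _) H|exact: le_trans (Im_le_cmod _) H].
- move=> u; set S := [set x | _].
  apply: (@annulus_piece_measure_le S b1 b2) => //.
  + exact: measurable_tuple_set.
  + by rewrite !mulr_ge0 ?invr_ge0 ?exprn_ge0// ltW.
  + exact: ltW.
  + by move=> p [_] /=; rewrite tnth_mktuple eqxx.
  + move=> p q [Sp /= cp] [Sq /= cq].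
    have [[Bp /= qp] _] := Sp; have [[Bq /= qq] _] := Sq.
    have cpc : c <= cmod p.
      by apply: le_trans cp _; rewrite tnth_mktuple eqxx signed_coord_le_cmod.
    have H1 : cmod (tnth z j) * cmod (p - q) <= 2 * s.
      rewrite -(cmodJ (p - q)) -cmodM.
      rewrite (_ : _ * _ = (1 - cdot z (tuple_set j u q)) -
        (1 - cdot z (tuple_set j u p))); last first.
        by rewrite !cdot_tuple_set rmorphB/=; ring.
      apply: le_trans (cmodD _ _) _; rewrite cmodN.
      by move: qp qq; rewrite /qdist; lra.
    have cp0 := cmod_ge0 (p - q); have c2 : 0 < c ^+ 2 by rewrite exprn_gt0.
    rewrite mulrAC ler_pdivlMr//.
    (* If z_j is small, [H1] is useless, but then |p - z_j| >= c/2 forces s >= c^2 / 8, and the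
       trivial bound |p - q| <= 2 is enough. *)
    have [zj|zj] := leP (c / 2) (cmod (tnth z j)).
      have : c / 2 * cmod (p - q) <= 2 * s.
        by apply: le_trans H1; rewrite ler_wpM2r.
      by nra.
    have pz : c / 2 <= cmod (p - tnth z j).
      have := cmodD (p - tnth z j) (tnth z j); rewrite subrK; lra.
    have sc : (c / 2) ^+ 2 <= 2 * s.
      apply: le_trans (sqs _ Sp); apply: le_trans (sqr_cmod_le_sqdist _ _ j).
      by rewrite tnth_mktuple eqxx ler_pXn2r ?nnegrE ?cmod_ge0//; lra.
    have pq2 : cmod (p - q) <= 2.
      apply: le_trans (cmodD _ _) _; rewrite cmodN.
      have := cmod_le1 j Bp; have := cmod_le1 j Bq.
      by rewrite !tnth_mktuple eqxx; lra.
    by nra.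
  + move=> p q [[[/unit_ballE Bp _] /= tp] _] [[[/unit_ballE Bq _] /= tq] _].
    by move: Bp tp Bq tq; rewrite !defect_tuple_set; lra.
Qed.

Lemma strip_measure_le : exists2 C : R, 0 <= C & forall (z : V) s t,
  B z -> 0 < s -> 0 < t -> (L (strip z s t) <= (C * s ^+ n.+1 * t)%:E)%E.
Proof.
pose v := fine (L B).
have v0 : 0 <= v by rewrite fine_ge0.
pose N : R := n.+1%:R.
have N1 : 1 <= N by rewrite /N ler1n.
pose c : R := (2 * N)^-1.
have c0 : 0 < c by rewrite invr_gt0; lra.
have cE : c * (2 * N) = 1 by rewrite /c mulVf// gt_eqF//; lra.
have c12 : c <= 2^-1 by nra.
pose C1 : R := 2 / c * (16 / c ^+ 2) * 8 ^+ n.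
have ci : 0 <= c^-1 by rewrite invr_ge0 ltW.
have C10 : 0 <= C1.
  rewrite /C1 -exprVn; apply: mulr_ge0; rewrite ?exprn_ge0//.
  by apply: mulr_ge0; rewrite mulr_ge0 ?exprn_ge0.
exists (v * 2 * 4 ^+ n.+1 + #|{: 'I_n.+1 * bool * bool}|%:R * C1).
  by apply: addr_ge0; apply: mulr_ge0 => //; rewrite ?exprn_ge0// mulr_ge0.
move=> z s t Bz s0 t0.
have sn0 : 0 <= s ^+ n.+1 by rewrite exprn_ge0// ltW.
have dlt u : strip z s t u -> defect u < 2 * s.
  move=> [[Bu /= qu] _]; apply: le_lt_trans (defect_le_qdist u Bz) _.
  by rewrite qdistC ltr_pM2l.
(* When both parameters are large, the volume of the whole ball suffices, since 1 <= 2t and 1 <= 4s.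
   Otherwise depths in the strip are below 1/2, so |u|^2 > 1/2 and some coordinate is not small. *)
have [/andP[t2 s2]|] := boolP ((2^-1 < t) && (2^-1 < 2 * s)).
  apply: (@le_trans _ _ v%:E).
    rewrite /v fineK ?lebesgue_Cd_unit_ball_fin_num//.
    apply: le_measure; rewrite ?inE; [exact: measurable_strip|exact: measurable_unit_ball|].
    by move=> u [[]].
  rewrite lee_fin mulrDl mulrDl (@le_trans _ _ (v * 2 * 4 ^+ n.+1 * s ^+ n.+1 * t))//.
    have H : 1 <= 4 ^+ n.+1 * s ^+ n.+1 by rewrite -exprMn exprn_ege1//; lra.
    rewrite (_ : _ * t = v * (4 ^+ n.+1 * s ^+ n.+1 * (2 * t))); last by ring.
    by rewrite ler_peMr// mulr_ege1//; lra.
  by rewrite lerDl; apply: mulr_ge0 (ltW t0); apply: mulr_ge0 => //; exact: mulr_ge0.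
rewrite negb_and -!leNgt => ts.
pose F (k : 'I_n.+1 * bool * bool) := strip z s t `&`
  [set u | c <= signed_coord k.1.2 k.2 (tnth u k.1.1)].
have mF k : measurable (F k).
  apply: measurableI; first exact: measurable_strip.
  apply: (measurable_ge c (f := signed_coord k.1.2 k.2 \o (fun u : V => tnth u k.1.1))).
  exact: (measurableT_comp (measurable_signed_coord _ _) (@measurable_tnth _ R[i] n.+1 _)).
have SF u : strip z s t u -> exists k, F k u.
  move=> Su; have half : 2^-1 < \sum_(j < n.+1) cmod (tnth u j) ^+ 2.
    have := dlt _ Su; have [[_ _] /=] := Su; rewrite /defect.
    by case/orP : ts; lra.
  have [j Hj] : exists j : 'I_n.+1, 2 * c ^+ 2 <= cmod (tnth u j) ^+ 2.
    apply: contrapT => /forallNP H; move: half; apply/negP; rewrite -leNgt.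
    apply: (@le_trans _ _ (\sum_(j < n.+1) 2 * c ^+ 2)).
      by apply: ler_sum => j _; have /negP := H j; rewrite -ltNge => /ltW.
    rewrite sumr_const card_ord -[leLHS]mulr_natr -/N.
    by nra.
  have [b1 [b2 Hb]] := exists_signed_coord_ge (ltW c0) Hj.
  by exists (j, b1, b2).
apply: le_trans (measure_le_sum (lebesgue_Cd R n.+1) (measurable_strip z s t) mF SF) _.
apply: (@le_trans _ _ (\sum_(k : 'I_n.+1 * bool * bool) (C1 * s ^+ n.+1 * t)%:E)%E).
  apply: lee_sum => k _.
  apply: le_trans (strip_piece_measure_le k.1.1 k.1.2 k.2 Bz s0 t0 c0 c12) _.
  rewrite lee_fin le_eqVlt; apply/orP; left; apply/eqP.
  by rewrite /C1 exprMn [s ^+ n.+1]exprS; ring.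
rewrite sumEFin lee_fin sumr_const -[leLHS]mulr_natl.
rewrite [leRHS](_ : _ = v * 2 * 4 ^+ n.+1 * s ^+ n.+1 * t +
  #|{: 'I_n.+1 * bool * bool}|%:R * (C1 * s ^+ n.+1 * t)); last by ring.
rewrite lerDr; apply: mulr_ge0 (ltW t0); apply: mulr_ge0 => //.
by apply: mulr_ge0; rewrite ?exprn_ge0// mulr_ge0.
Qed.

End strip.

(** * Lower bound for the volume of tents *)

Section lower_volume.
Variables (R : realType) (n : nat).
Notation V := (n.+1.-tuple R[i]).
Notation B := (unit_ball R n.+1).
Notation L := (lebesgue_Cd R n.+1).

(** A Whitney-type region around [w], on which the depth is comparable to that of [w]. Point masses
    will be spread over it. *)
Definition tent (w : V) : set V :=
  B `&` [set u | qdist u w <= 2 * defect w] `&` [set u | defect w / 2 <= defect u].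

Lemma measurable_tent w : measurable (tent w).
Proof.
apply: measurableI; first apply: measurableI.
- exact: measurable_unit_ball.
- rewrite (_ : [set _ | _] = [set u | - (2 * defect w) <= - qdist w u]); last first.
    by apply/seteqP; split => u /=; rewrite lerN2 qdistC.
  by apply: measurable_ge; apply: measurableT_comp => //; exact: measurable_qdist.
- by apply: measurable_ge; exact: measurable_defect.
Qed.

(* [tent w] contains the sheared box of the points [u] for which [u - w] has
   coordinates of size [sqrt (defect w)], up to a constant, except for one, chosen
   so that [<u - w, w>] has size [defect w]. *)
Lemma tent_measure_ge : exists2 c : R, 0 < c & forall w : V, B w ->
  ((c * defect w ^+ n.+2)%:E <= L (tent w))%E.
Proof.
pose N : R := n.+1%:R.
have N1 : 1 <= N by rewrite /N ler1n.
(* Small enough for both |y - w|^2 and |<y - w, w>| to be at most t / 8 below. *)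
pose e : R := (16 * N ^+ 2)^-1.
have e0 : 0 < e by rewrite invr_gt0; nra.
have eE : e * (16 * N ^+ 2) = 1 by rewrite /e mulVf// gt_eqF//; nra.
exists ((2 * e) ^+ 2 * ((2 * e) ^+ 2) ^+ n).
  by rewrite !mulr_gt0 ?exprn_gt0 ?mulr_gt0.
move=> w /[dup] Bw /unit_ballE; set t := defect w => t0.
have t1 : t <= 1 by exact: defect_le1.
pose st := Num.sqrt t.
have st0 : 0 <= st by exact: sqrtr_ge0.
have stE : st ^+ 2 = t by rewrite sqr_sqrtr// ltW.
have tst : t <= st by rewrite -stE; nra.
(* The largest coordinate of [w] carries the shear, so that the coefficients [g i] have modulus at
   most 1. If it vanishes then w = 0, and the convention 0^-1 = 0 makes the shear trivial. *)
have [j _ jmax] := arg_maxP (fun i : 'I_n.+1 => cmod (tnth w i)) (isT : xpredT ord0).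
pose X (i : 'I_n.+1) := csquare (tnth w i) (e * st).
rewrite (_ : _ * _ = ((2 * (e * t)) ^+ 2) * ((2 * (e * st)) ^+ 2) ^+ n); last first.
  have stn : st ^+ n * st ^+ n = t ^+ n by rewrite -exprMn -expr2 stE.
  rewrite !exprMn [RHS](_ : _ = 2 ^+ 2 * e ^+ 2 * (2 ^+ n * 2 ^+ n *
    (e ^+ n * e ^+ n)) * (t ^+ 2 * (st ^+ n * st ^+ n))); last by ring.
  by rewrite stn; congr (_ * _); exact: (exprD t 2 n).
apply: (@tuple_measure_slice_ge _ _ _ _ n j (tent w) X).
- by rewrite exprn_ge0// !mulr_ge0// ltW.
- by rewrite exprn_ge0// !mulr_ge0// ltW.
- exact: measurable_tent.
- by move=> i; exact: measurable_csquare.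
- move=> i; rewrite [LHS]complex_measure_csquare ?mulr_ge0 ?(ltW e0)//.
  by rewrite mulr_natl.
move=> u Xu.
pose h i := tnth u i - tnth w i.
have hle i : i != j -> cmod (h i) <= 2 * (e * st).
  move=> /Xu/csquareP[h1 h2]; apply: le_trans (cmod_le_ReIm _) _.
  by rewrite /h ReB ImB mulr2n mulrDl !mul1r lerD.
pose g i := conjc (tnth w i) / conjc (tnth w j).
have gle i : cmod (g i) <= 1.
  rewrite cmodM cmodV !cmodJ.
  have [->|wj0] := eqVneq (cmod (tnth w j)) 0; first by rewrite invr0 mulr0.
  have wjp : 0 < cmod (tnth w j) by rewrite lt_def wj0 cmod_ge0.
  by rewrite ler_pdivrMr// mul1r; exact: jmax.
(* Placing the j-th coordinate at [ctr] cancels the contribution of all the others to <y - w, w>,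
   which becomes [(x - ctr) * conjc (tnth w j)]. *)
pose ctr := tnth w j - \sum_(i < n.+1 | i != j) h i * g i.
have -> : ((2 * (e * t)) ^+ 2)%:E = complex_lebesgue_measure (csquare ctr (e * t)).
  by rewrite complex_measure_csquare ?mulr_ge0 ?(ltW e0) ?(ltW t0)// -[in RHS]mulr_natl.
apply: le_measure; rewrite ?inE; first exact: measurable_csquare.
  by apply: measurable_tuple_set; exact: measurable_tent.
move=> x /csquareP[x1 x2] /=.
have xc : cmod (x - ctr) <= 2 * (e * t).
  apply: le_trans (cmod_le_ReIm _) _.
  by rewrite ReB ImB mulr2n mulrDl !mul1r lerD.
set y := tuple_set j u x.
have hw : cmod (\sum_(i < n.+1) (tnth y i - tnth w i) * conjc (tnth w i)) <=
    2 * (e * t).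
  rewrite (_ : \sum_(i < n.+1) _ = (x - ctr) * conjc (tnth w j)).
    by rewrite cmodM cmodJ; apply: le_trans xc; rewrite ler_piMr ?cmod_ge0// cmod_le1.
  rewrite (bigD1 j)//= tnth_mktuple eqxx /ctr.
  rewrite (eq_bigr (fun i => h i * g i * conjc (tnth w j))); last first.
    move=> i ij; rewrite tnth_mktuple (negbTE ij) -/(h i) -mulrA; congr (_ * _).
    rewrite /g; have [wj0|wj0] := eqVneq (conjc (tnth w j)) 0; last by rewrite divfK.
    rewrite wj0 mulr0; apply/eqP; rewrite -cmod_eq0 cmodJ eq_le cmod_ge0 andbT.
    by have := jmax i isT; rewrite -(cmodJ (tnth w j)) wj0 cmod0.
  by rewrite -mulr_suml; ring.
have hj : cmod (x - tnth w j) <= 2 * N * (e * st).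
  rewrite (_ : x - tnth w j = (x - ctr) - \sum_(i < n.+1 | i != j) h i * g i);
    last by rewrite /ctr; ring.
  apply: le_trans (cmodD _ _) _; rewrite cmodN.
  have H : cmod (\sum_(i < n.+1 | i != j) h i * g i) <= n%:R * (2 * (e * st)).
    apply: le_trans (cmod_sum _ _ _) _.
    apply: (@le_trans _ _ (\sum_(i < n.+1 | i != j) 2 * (e * st))).
      apply: ler_sum => i ij; rewrite cmodM -[leRHS]mulr1.
      by apply: ler_pM; rewrite ?cmod_ge0 ?hle.
    rewrite (eq_bigl (fun i => i \in predC1 j))// sumr_const cardC1 card_ord.
    by rewrite -[leLHS]mulr_natl.
  have NE : N = n%:R + 1 by rewrite /N -natr1.
  have ets : e * t <= e * st by rewrite ler_wpM2l// ltW.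
  rewrite NE; move: xc H ets; move: (e * t) (e * st) (n%:R : R) (cmod _) (cmod _).
  by move=> a1 a2 a3 a4 a5; lra.
have hsq : sqdist y w <= N * (2 * N * (e * st)) ^+ 2.
  apply: (@le_trans _ _ (\sum_(i < n.+1) (2 * N * (e * st)) ^+ 2)).
    apply: ler_sum => i _; rewrite ler_pXn2r ?nnegrE ?cmod_ge0 ?mulr_ge0//; try lra.
    have [->|ij] := eqVneq i j; first by rewrite tnth_mktuple eqxx.
    rewrite tnth_mktuple (negbTE ij); apply: le_trans (hle _ ij) _.
    have : 0 <= e * st by rewrite mulr_ge0// ltW.
    by nra.
  by rewrite sumr_const card_ord -[leLHS]mulr_natl.
have hsq8 : sqdist y w <= t / 8.
  apply: le_trans hsq _.
  rewrite (_ : _ * _ = 4 * (e * N ^+ 2) * (e * N) * st ^+ 2); last by ring.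
  have -> : e * N ^+ 2 = 16^-1 by lra.
  have : e * N <= 16^-1.
    have : e * N <= e * N ^+ 2 by rewrite ler_wpM2l ?(ltW e0)//; nra.
    by lra.
  by rewrite stE; nra.
have qy : 1 - cdot y w = Complex t 0 -
    \sum_(i < n.+1) (tnth y i - tnth w i) * conjc (tnth w i).
  rewrite -onem_cdot_self (_ : \sum_(i < _) _ = cdot y w - cdot w w); first by ring.
  by rewrite /cdot -sumrN -big_split; apply: eq_bigr => i _; rewrite mulrBl.
have et : 2 * (e * t) <= t / 8 by nra.
(* [Re_cdot] gives defect y = t - 2 Re <y - w, w> - |y - w|^2, hence at least t - t/4 - t/8. *)
have dy : t / 2 <= defect y.
  have := Re_cdot y w; rewrite -/t qy ReB/=.
  set z := \sum_(i < _) _ in hw * => E.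
  have := Re_le_cmod z; rewrite ler_norml => /andP[_ H].
  lra.
split; last exact: dy.
split; first by apply/unit_ballE; lra.
rewrite /= /qdist qy; apply: le_trans (cmodD _ _) _.
rewrite cmodN cmod_real (gtr0_norm t0) -/t; lra.
Qed.

End lower_volume.

Section kernel_integrals.
Variables (R : realType) (n : nat).
Notation V := (n.+1.-tuple R[i]).
Notation B := (unit_ball R n.+1).
Notation L := (lebesgue_Cd R n.+1).

Let half_powR_lt1 (a : R) : 0 < a -> 2^-1 `^ a < 1 :> R.
Proof.
move=> a0; have := @gt0_ltr_powR R a a0 2^-1 1; rewrite powR1; apply.
- by rewrite nnegrE.
- by rewrite nnegrE.
- by rewrite invf_lt1// ltr1n.
Qed.

Let measurable_qball (z : V) s : measurable (B `&` [set u | qdist z u < s]).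
Proof.
apply: measurableI; first exact: measurable_unit_ball.
by apply: measurable_lt; exact: measurable_qdist.
Qed.

Let integral_one (D : set V) : measurable D ->
  (\int[L]_(x in D) (cst (1 : R) x)%:E = L D)%E.
Proof. by move=> mD; rewrite -[RHS]mul1e -integral_cst. Qed.

(** A q-ball of radius s is a strip with t = 2s, since the depth is at most twice q. *)
Lemma qball_measure_le : exists2 C : R, 0 <= C & forall (z : V) s,
  B z -> 0 < s -> (L (B `&` [set u | (qdist z u < s)%R]) <= (C * s ^+ n.+2)%:E)%E.
Proof.
have [C C0 HC] := strip_measure_le R n.
exists (C * 2); first by rewrite mulr_ge0.
move=> z s Bz s0; have s20 : 0 < 2 * s by lra.
apply: le_trans (le_trans _ (HC z s (2 * s) Bz s0 s20)) _; last first.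
  by rewrite lee_fin [s ^+ n.+2]exprSr le_eqVlt; apply/orP; left; apply/eqP; ring.
apply: le_measure; rewrite ?inE; [exact: measurable_qball|exact: measurable_strip|].
move=> u [Bu /= qu]; split => //=; apply: le_lt_trans (defect_le_qdist u Bz) _.
by rewrite qdistC ltr_pM2l.
Qed.

Lemma qball_integral_le (alpha : R) : 0 < alpha < n.+2%:R ->
  exists2 C : R, 0 <= C & forall (w : V) s, B w -> 0 < s ->
  (\int[L]_(u in B `&` [set u | (qdist w u < s)%R]) (qdist w u `^ (- alpha))%:E <=
   (C * s `^ (n.+2%:R - alpha))%:E)%E.
Proof.
move=> /andP[al0 aln]; have [A A0 HA] := qball_measure_le.
have th1 : 2^-1 `^ (n.+2%:R - alpha) < 1 :> R by apply: half_powR_lt1; lra.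
exists (A * 2 `^ n.+2%:R * 2^-1 `^ (n.+2%:R - alpha) /
    (1 - 2^-1 `^ (n.+2%:R - alpha))).
  by rewrite divr_ge0 ?subr_ge0 ?(ltW th1)// mulr_ge0 ?powR_ge0// mulr_ge0 ?powR_ge0.
move=> w s Bw s0; set D := _ `&` _.
have mD : measurable D by exact: measurable_qball.
have := @shell_integral_le _ _ _ L D (cst 1) (qdist w) alpha n.+2%:R A (s / 2) 2^-1 mD
  (measurable_cst _) (measurable_qdist _) (fun=> ler01) _ _ A0 (ltW al0) th1.
set e := _ - alpha in th1 *.
have -> : A * 2 `^ n.+2%:R * (s / 2) `^ e / (1 - 2^-1 `^ e) =
    A * 2 `^ n.+2%:R * 2^-1 `^ e / (1 - 2^-1 `^ e) * s `^ e.
  by rewrite [s / 2]mulrC powRM ?(ltW s0)//; ring.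
under [X in (X <= _)%E]eq_integral do rewrite mul1r.
apply => //.
- by rewrite divr_gt0.
- move=> r r0; rewrite integral_one; last first.
    by apply: measurableI => //; apply: measurable_lt; exact: measurable_qdist.
  rewrite powR_mulrn ?(ltW r0)//; apply: le_trans (HA w r Bw r0).
  apply: le_measure; rewrite ?inE; [|exact: measurable_qball|].
    by apply: measurableI => //; apply: measurable_lt; exact: measurable_qdist.
  by move=> u [[Bu _] qu].
- move=> u [Bu /= qu]; apply: dyadic_shell_down; first exact: qdist_gt0.
  by rewrite mulrC divfK.
Qed.

(* Instance of the Forelli-Rudin estimates. *)
Lemma forelli_rudin : exists2 C : R, 0 <= C & forall z : V, B z ->
  (\int[L]_(u in B) (defect u `^ (- 2^-1) * qdist z u `^ (- n.+2%:R))%:E <=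
   (C * defect z `^ (- 2^-1))%:E)%E.
Proof.
have [A A0 HA] := strip_measure_le R n.
have th1 : 2^-1 `^ (1 - 2^-1) < 1 :> R by apply: half_powR_lt1; lra.
pose A1 := A * 2 `^ 1 / (1 - 2^-1 `^ (1 - 2^-1)).
have A10 : 0 <= A1.
  by rewrite divr_ge0 ?subr_ge0 ?(ltW th1)// mulr_ge0 ?powR_ge0.
pose b : R := n.+1%:R + 2^-1.
have bE : b - n.+2%:R = - 2^-1 by rewrite /b -[n.+2%:R]natr1; lra.
have th2 : 2 `^ (b - n.+2%:R) < 1 :> R.
  by rewrite bE powRN -powR_inv1// powRAC powR_inv1//; apply: half_powR_lt1.
exists (A1 * 2 `^ b * 2^-1 `^ (- 2^-1) / (1 - 2 `^ (b - n.+2%:R))).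
  by rewrite divr_ge0 ?subr_ge0 ?(ltW th2)// mulr_ge0 ?powR_ge0// mulr_ge0 ?powR_ge0.
move=> z Bz; have /unit_ballE z0 := Bz.
(* Shells of the depth inside a q-ball: the strip volume r^(n+1) t beats t^(-1/2), and summation up
   to depth 2r leaves the exponent n + 1 + 1/2. *)
have step1 r : 0 < r ->
    (\int[L]_(u in B `&` [set u | (qdist z u < r)%R]) (defect u `^ (- 2^-1))%:E
     <= (A1 * r `^ b)%:E)%E.
  move=> r0; set D := _ `&` _.
  have mD : measurable D by exact: measurable_qball.
  have := @shell_integral_le _ _ _ L D (cst 1) (@defect R n.+1) 2^-1 1
    (A * r ^+ n.+1) r 2^-1 mD (measurable_cst _) (@measurable_defect R _)
    (fun=> ler01) r0 _ _ _ th1.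
  under [X in (X <= _)%E]eq_integral do rewrite mul1r.
  have -> : A * r ^+ n.+1 * 2 `^ 1 * r `^ (1 - 2^-1) / (1 - 2^-1 `^ (1 - 2^-1)) =
      A1 * r `^ b.
    rewrite /A1 (_ : 1 - 2^-1 = 2^-1 :> R); last by lra.
    rewrite /b powRD ?(gt_eqF r0) ?implybT// powR_mulrn ?(ltW r0)//; ring.
  apply => //.
  - by rewrite mulr_ge0 ?exprn_ge0 ?(ltW r0).
  - move=> t t0; rewrite integral_one; last first.
      by apply: measurableI => //; apply: measurable_lt; exact: measurable_defect.
    by rewrite powRr1 ?(ltW t0)//; exact: HA.
  - move=> u [/[dup] Bu /unit_ballE u0 /= qu].
    apply: dyadic_shell_down => //; apply: le_lt_trans (defect_le_qdist u Bz) _.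
    by rewrite qdistC ltr_pM2l.
(* Shells of q now grow outwards from [defect z / 2], a lower bound of [qdist z] on the ball; since
   b - (n+2) = -1/2, the sum converges and is governed by its first term. *)
have := @shell_integral_le _ _ _ L B (fun u => defect u `^ (- 2^-1)) (qdist z)
  n.+2%:R b A1 (defect z / 2) 2 (@measurable_unit_ball R n.+1) _ (measurable_qdist _)
  (fun u => powR_ge0 _ _) _ _ A10 _ th2.
have -> : A1 * 2 `^ b * (defect z / 2) `^ (b - n.+2%:R) / (1 - 2 `^ (b - n.+2%:R)) =
    A1 * 2 `^ b * 2^-1 `^ (- 2^-1) / (1 - 2 `^ (b - n.+2%:R)) * defect z `^ (- 2^-1).
  by rewrite [in _ `^ (b - _)]bE [defect z / 2]mulrC powRM ?(ltW z0)//; ring.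
apply => //.
- exact: (measurableT_comp (measurable_powR _) (@measurable_defect R _)).
- by rewrite divr_gt0.
- move=> u Bu; apply: dyadic_shell_up; first by rewrite divr_gt0.
  by rewrite ler_pdivrMr// mulrC defect_le_qdist.
Qed.

End kernel_integrals.

(** * Finite sums of point masses *)

Lemma powRN_le (R : realType) (a b c e : R) : 0 < a -> 0 < b -> 0 < c -> 0 <= e ->
  a <= c * b -> b `^ (- e) <= c `^ e * a `^ (- e).
Proof.
move=> a0 b0 c0 e0 acb; rewrite !powRN ler_pdivlMr ?powR_gt0//.
rewrite mulrC ler_pdivrMr ?powR_gt0// -powRM ?(ltW b0) ?(ltW c0)//.
by apply: ge0_ler_powR; rewrite ?nnegrE ?mulr_ge0 ?(ltW a0) ?(ltW b0) ?(ltW c0).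
Qed.

Lemma chebyshev_sum dT (T : measurableType dT) (R : realType)
    (mu : {measure set T -> \bar R}) (I : finType) (E : set T) (lambda : R)
    (m J : I -> R) (F : I -> T -> R) :
  measurable E -> 0 <= lambda -> (forall i, 0 <= m i) ->
  (forall i, measurable_fun setT (F i)) -> (forall i x, 0 <= F i x) ->
  (forall x, E x -> lambda <= \sum_i m i * F i x) ->
  (forall i, (\int[mu]_(x in E) (F i x)%:E <= (J i)%:E)%E) ->
  (lambda%:E * mu E <= (\sum_i m i * J i)%:E)%E.
Proof.
move=> mE l0 m0 mF F0 EF FJ.
have mFE i : measurable_fun E (fun x => (F i x)%:E).
  by apply: measurable_funTS; apply/measurable_EFinP; exact: mF.
have mmFE i : measurable_fun E (fun x => ((m i)%:E * (F i x)%:E)%E).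
  exact: emeasurable_funM.
rewrite -integral_cst//.
apply: (@le_trans _ _ (\int[mu]_(x in E) \sum_i ((m i)%:E * (F i x)%:E))%E).
  apply: ge0_le_integral => //.
  - exact: emeasurable_sum.
  - move=> x Ex; rewrite (eq_bigr (fun i => (m i * F i x)%:E)) => [|i _];
      last by rewrite EFinM.
    by rewrite sumEFin lee_fin EF.
rewrite ge0_integral_sum//; last first.
  by move=> i x _; rewrite -EFinM lee_fin mulr_ge0.
rewrite -sumEFin; apply: lee_sum => i _; rewrite ge0_integralZl_EFin//.
- by rewrite EFinM; apply: lee_wpmul2l; rewrite ?lee_fin.
- by move=> x _; rewrite lee_fin.
Qed.

Section discrete_weak_type.
Variables (R : realType) (n : nat).
Notation V := (n.+1.-tuple R[i]).
Notation B := (unit_ball R n.+1).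
Notation L := (lebesgue_Cd R n.+1).

Definition potential (I : finType) (w : I -> V) (m : I -> R) (alpha : R) (z : V) : R :=
  \sum_i m i * qdist (w i) z `^ (- alpha).

Definition superlevel I w m alpha (lambda : R) : set V :=
  B `&` [set z | lambda < @potential I w m alpha z].

Lemma measurable_kernel (w : V) a : measurable_fun setT (fun z => qdist w z `^ a).
Proof. exact: (measurableT_comp (measurable_powR _) (@measurable_qdist R _ w)). Qed.

Lemma measurable_superlevel I w m alpha lambda :
  measurable (@superlevel I w m alpha lambda).
Proof.
apply: measurableI; first exact: measurable_unit_ball.
rewrite (_ : [set _ | _] = [set z | - potential w m alpha z < - lambda]); last first.
  by apply/seteqP; split => z /=; rewrite ltrN2.
apply: measurable_lt; apply: measurableT_comp => //.
by apply: measurable_sum => i; apply: measurable_funM => //; exact: measurable_kernel.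
Qed.

(** Unnormalized volume; the normalizing factor of [dv] is restored only for the operators. *)
Definition vol (A : set V) : R := fine (L A).

Lemma vol_ge0 A : 0 <= vol A. Proof. exact: fine_ge0. Qed.

Lemma volK A : measurable A -> A `<=` B -> (vol A)%:E = L A.
Proof.
move=> mA AB; rewrite /vol fineK// ge0_fin_numE//.
apply: (@le_lt_trans _ _ (L B)).
  by apply: le_measure => //; rewrite inE//; exact: measurable_unit_ball.
by have := lebesgue_Cd_unit_ball_fin_num R n.+1; rewrite ge0_fin_numE.
Qed.

(** Split E at the radius s with s^(n+2) = vol E: inside, integrate over the whole q-ball; outside,
    the kernel is at most s^(-alpha). Both parts have the same order. *)
Lemma kernel_set_integral_le (alpha : R) : 0 < alpha < n.+2%:R ->
  exists2 C : R, 0 <= C & forall (w : V) (E : set V), B w -> measurable E ->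
  E `<=` B -> 0 < vol E ->
  (\int[L]_(z in E) (qdist w z `^ (- alpha))%:E <=
   (C * vol E `^ (1 - alpha / n.+2%:R))%:E)%E.
Proof.
move=> /andP[al0 aln].
have [C C0 HC] := @qball_integral_le R n alpha (introT andP (conj al0 aln)).
exists (C + 1); first by rewrite addr_ge0.
move=> w E Bw mE EB e0; set e := vol E in e0 *.
have N0 : n.+2%:R != 0 :> R by rewrite pnatr_eq0.
pose s := e `^ (n.+2%:R^-1).
have s0 : 0 < s by rewrite powR_gt0.
have mq : measurable [set u | qdist w u < s] by apply: measurable_lt; exact: measurable_qdist.
have mk : measurable_fun setT (fun z => (qdist w z `^ (- alpha))%:E).
  by apply/measurable_EFinP; exact: measurable_kernel.
pose g := (fun z => (qdist w z `^ (- alpha))%:E) \_ [set u | qdist w u < s].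
have mg : measurable_fun E g.
  by apply: measurable_funTS; apply/(measurable_restrictT _ _).1 => //; exact: measurable_funTS.
have g0 z : (0 <= g z)%E by rewrite /g patchE; case: ifP => //= _; rewrite lee_fin powR_ge0.
apply: (@le_trans _ _ (\int[L]_(z in E) (g z + (s `^ (- alpha))%:E))%E).
  apply: ge0_le_integral => //.
  - by move=> z _; rewrite lee_fin powR_ge0.
  - exact: measurable_funTS.
  - by apply: emeasurable_funD.
  - move=> z Ez; rewrite /g patchE; case: ifPn => [_|].
      by rewrite leeDl// lee_fin powR_ge0.
    rewrite notin_setE/= => /negP; rewrite -leNgt => sz; rewrite add0e lee_fin.
    rewrite !powRN lef_pV2 ?posrE ?powR_gt0//; last exact: lt_le_trans sz.
    apply: ge0_ler_powR; rewrite ?nnegrE//; [exact: ltW|exact: ltW|].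
    exact: le_trans (ltW s0) sz.
rewrite ge0_integralD//; last by move=> z _; rewrite lee_fin powR_ge0.
rewrite integral_cst// -integral_mkcondr [X in (_ + _ * X)%E](_ : _ = e%:E);
  last exact/esym/volK.
rewrite -EFinM mulrDl mul1r EFinD.
apply: leeD.
  apply: (@le_trans _ _ (C * s `^ (n.+2%:R - alpha))%:E).
    apply: le_trans (HC w s Bw s0); apply: ge0_subset_integral => //.
    - exact: measurableI.
    - by apply: measurableI => //; exact: measurable_unit_ball.
    - exact: measurable_funTS.
    - by move=> z _; rewrite lee_fin powR_ge0.
    - by move=> z [/EB].
  by rewrite lee_fin /s -powRrM mulrBr mulVf// [_^-1 * alpha]mulrC.
rewrite lee_fin /s -powRrM -{2}(powRr1 (ltW e0)) -powRD ?(gt_eqF e0) ?implybT//.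
by rewrite mulrN [_^-1 * alpha]mulrC addrC.
Qed.

Lemma weak_type_subcritical (alpha : R) : 0 < alpha < n.+2%:R ->
  exists2 C : R, 0 <= C & forall (I : finType) (w : I -> V) (m : I -> R) lambda,
  (forall i, B (w i)) -> (forall i, 0 <= m i) -> 0 < lambda ->
  lambda * vol (superlevel w m alpha lambda) `^ (alpha / n.+2%:R) <= C * \sum_i m i.
Proof.
move=> al; have [C C0 HC] := kernel_set_integral_le al; move: al => /andP[al0 aln].
exists C => // I w m lambda Bw m0 l0; set E := superlevel _ _ _ _.
have mE : measurable E by exact: measurable_superlevel.
have EB : E `<=` B by move=> z [].
have [e0|e0] := ltP 0 (vol E); last first.
  have -> : vol E = 0 by apply/eqP; rewrite eq_le e0 vol_ge0.
  rewrite powR0 ?mulr0 ?mulr_ge0 ?sumr_ge0//.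
  by rewrite mulf_neq0 ?invr_neq0 ?pnatr_eq0// gt_eqF.
have := @chebyshev_sum _ _ _ L I E lambda m
  (fun=> C * vol E `^ (1 - alpha / n.+2%:R)) (fun i z => qdist (w i) z `^ (- alpha)).
rewrite [X in (_ * X <= _)%E](_ : _ = (vol E)%:E); last exact/esym/volK.
rewrite -EFinM lee_fin -mulr_suml => H.
have {}H : lambda * vol E <= (\sum_i m i) * (C * vol E `^ (1 - alpha / n.+2%:R)).
  apply: H => //.
  - exact: ltW.
  - by move=> i; exact: measurable_kernel.
  - by move=> i z; rewrite powR_ge0.
  - by move=> z [_ /= /ltW].
  - by move=> i; exact: HC.
have p0 : 0 < vol E `^ (1 - alpha / n.+2%:R) by rewrite powR_gt0.
rewrite -(ler_pM2r p0) -mulrA -powRD ?(gt_eqF e0) ?implybT//.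
by rewrite addrC subrK powRr1 ?(ltW e0)// [leRHS]mulrAC [leRHS]mulrC.
Qed.

End discrete_weak_type.

(** Vitali selection: keep an index of maximal radius, discard all that meet it, repeat. Here [N i]
    is the set of masses captured by the i-th ball rather than the ball itself, because disjointness
    serves only to count no mass twice. An empty [N i] meets nothing, hence the nonemptiness
    condition. *)
Lemma greedy_disjoint_subfamily (R : realType) (I : finType) (A : {set I})
    (s : I -> R) (N : I -> {set I}) :
  exists J : {set I}, [/\ J \subset A,
    (forall i j, i \in J -> j \in J -> i != j -> N i :&: N j = finset.set0) &
    (forall i, i \in A -> N i != finset.set0 -> exists j, [/\ j \in J, s i <= s j &
      N i :&: N j != finset.set0])].
Proof.
have [k] := ubnP #|A|; elim: k A => // k IHk A; rewrite ltnS => Ak.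
have [->|[i0 i0A]] := set_0Vmem A.
  exists finset.set0; split => //; first by move=> i j; rewrite finset.inE.
  by move=> i; rewrite finset.inE.
have [i iA imax] : exists2 i, i \in A & forall j, j \in A -> s j <= s i.
  by case: (arg_maxP s i0A) => i iA imax; exists i.
pose A' := [set j in A | N j :&: N i == finset.set0]%SET :\ i.
have A'A : A' \subset A.
  by apply/fintype.subsetP => j; rewrite !finset.inE => /and3P[].
have A'i : i \notin A' by rewrite !finset.inE eqxx.
have [|J [JA' Jd Jc]] := IHk A'.
  apply: leq_trans Ak; apply: proper_card; apply/fintype.properP; split => //.
  by exists i.
exists (i |: J)%SET; split.
- by rewrite finset.subUset finset.sub1set iA (fintype.subset_trans JA').
- have JN j : j \in J -> N j :&: N i = finset.set0.
    by move=> /(fintype.subsetP JA'); rewrite !finset.inE => /and3P[_ _ /eqP].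
  move=> j1 j2; rewrite !finset.inE => /orP[/eqP->|j1J] /orP[/eqP->|j2J];
    rewrite ?eqxx//.
  + by rewrite finset.setIC JN.
  + by rewrite JN.
  + exact: Jd.
- move=> j jA Nj; have [jA'|jA'] := boolP (j \in A').
    have [k' [kJ sk dk]] := Jc _ jA' Nj.
    by exists k'; rewrite !finset.inE kJ orbT.
  exists i; rewrite !finset.inE eqxx imax//; split => //.
  move: jA'; rewrite !finset.inE jA/= negb_and negbK => /orP[/eqP jE|//].
  by rewrite jE finset.setIid -jE.
Qed.

(** * Critical exponent: stopping radii and the exceptional set *)

Section critical.
Variables (R : realType) (n : nat).
Notation V := (n.+1.-tuple R[i]).
Notation B := (unit_ball R n.+1).
Notation L := (lebesgue_Cd R n.+1).

Section stopping.
Variables (I : finType) (w : I -> V) (m : I -> R) (lambda : R).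
Hypothesis Bw : forall i, B (w i).
Hypothesis m0 : forall i, 0 <= m i.
Hypothesis ml : \sum_i m i < lambda.

Let qmass i s := \sum_(k | qdist (w i) (w k) < s) m k.

Let l0 : 0 < lambda.
Proof. by apply: le_lt_trans ml; exact: sumr_ge0. Qed.

Let qmass_le i s : qmass i s <= \sum_k m k.
Proof.
rewrite /qmass [leRHS](bigID (fun k => qdist (w i) (w k) < s))/= lerDl.
exact: sumr_ge0.
Qed.

(** The supremum of the radii with large mass need not be handled as attained: a qualifying radius
    above half of it is chosen, so that every radius from its double on fails. If no radius
    qualifies, sigma is 0. Radii s >= 1 fail because the total mass is below lambda. *)
Lemma stopping_radii : exists sigma : I -> R, forall i,
  [/\ 0 <= sigma i < 1, (0 < sigma i -> lambda * sigma i ^+ n.+2 <= qmass i (sigma i)) &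
      (forall s, 0 < s -> 2 * sigma i <= s -> qmass i s < lambda * s ^+ n.+2)].
Proof.
suff H i : exists s0 : R,
  [/\ 0 <= s0 < 1, (0 < s0 -> lambda * s0 ^+ n.+2 <= qmass i s0) &
      (forall s, 0 < s -> 2 * s0 <= s -> qmass i s < lambda * s ^+ n.+2)].
  by have [f Hf] := choice H; exists f.
pose S : set R := [set s | 0 < s /\ lambda * s ^+ n.+2 <= qmass i s].
have S1 s : S s -> s < 1.
  move=> [s0 Hs]; rewrite ltNge; apply/negP => s1.
  have : 1 <= s ^+ n.+2 by exact: exprn_ege1.
  have := le_trans Hs (qmass_le _ _); have := ml; have := l0; nra.
have [S0|/set0P[s1 Ss1]] := eqVneq S set0.
  exists 0; split; [by rewrite lexx ltr01|by rewrite ltxx|].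
  move=> s s0 _; rewrite ltNge; apply/negP => Hs.
  by have : S s by []; rewrite S0.
have hsS : has_sup S by split; [exists s1|exists 1 => s /S1/ltW].
have sS0 : 0 < sup S.
  by apply: lt_le_trans (sup_upper_bound hsS Ss1); case: Ss1.
have [s Ss sSs] := @sup_adherent _ S (sup S / 2) (divr_gt0 sS0 (ltr0Sn R 1)) hsS.
have [s0 Hs] := Ss.
exists s; split => //; first by rewrite (ltW s0) S1.
move=> s' s'0 ss'; rewrite ltNge; apply/negP => Hs'.
have : s' <= sup S by exact: (sup_upper_bound hsS).
lra.
Qed.

End stopping.

End critical.

Section bad_set.
Variables (R : realType) (n : nat).
Notation V := (n.+1.-tuple R[i]).
Notation B := (unit_ball R n.+1).
Notation L := (lebesgue_Cd R n.+1).

Lemma bad_set_measure_le : exists2 C : R, 0 <= C &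
  forall (I : finType) (w : I -> V) (m sigma : I -> R) lambda (E : set V),
  (forall i, B (w i)) -> (forall i, 0 <= m i) -> 0 < lambda ->
  measurable E -> E `<=` B ->
  (forall i, 0 < sigma i ->
    lambda * sigma i ^+ n.+2 <= \sum_(k | qdist (w i) (w k) < sigma i) m k) ->
  (forall z, E z -> exists i, qdist (w i) z < sigma i) ->
  lambda * vol E <= C * \sum_i m i.
Proof.
have [C C0 HC] := qball_measure_le R n.
(* If the i-th and j-th balls share a mass and sigma i <= sigma j, then q(w_j, w_i) <= 6 sigma j,
   and a point z of the i-th ball has q(w_j, z) <= 3 (6 + 1) sigma j, below 22 sigma j. *)
exists (C * 22 ^+ n.+2); first by rewrite mulr_ge0 ?exprn_ge0.
move=> I w m sigma lambda E Bw m0 l0 mE EB Hs Ebad.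
pose N i := [set k | qdist (w i) (w k) < sigma i]%SET.
have [J [JA Jd Jc]] := greedy_disjoint_subfamily [set i | 0 < sigma i]%SET sigma N.
have J0 j : j \in J -> 0 < sigma j.
  by move=> /(fintype.subsetP JA); rewrite finset.inE.
pose F j := B `&` [set z | qdist (w j) z < 22 * sigma j].
have mF j : measurable (F j).
  apply: measurableI; first exact: measurable_unit_ball.
  by apply: measurable_lt; exact: measurable_qdist.
pose F' j := if j \in J then F j else set0.
have mF' j : measurable (F' j) by rewrite /F'; case: ifP.
have EF z : E z -> exists j, F' j z.
  move=> Ez; have Bz := EB _ Ez; have [i zi] := Ebad _ Ez.
  have si : 0 < sigma i by apply: le_lt_trans zi; exact: qdist_ge0.
  have Ni : N i != finset.set0.
    apply/finset.set0Pn; apply: contrapT => /forallNP Nk.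
    have := Hs _ si; rewrite big1.
      by apply/negP; rewrite -ltNge mulr_gt0// exprn_gt0.
    by move=> k ik; exfalso; apply: (Nk k); rewrite finset.inE.
  have [|j [jJ sij /finset.set0Pn[k]]] := Jc _ _ Ni; first by rewrite finset.inE.
  rewrite !finset.inE => /andP[ik jk]; exists j; rewrite /F' jJ; split => //=.
  have := qdist_triangle (Bw j) (Bw i) Bz.
  have := qdist_triangle (Bw j) (Bw k) (Bw i).
  rewrite (qdistC (w k) (w i)); lra.
have H1 : (L E <= \sum_j L (F' j))%E by exact: (measure_le_sum L mE mF' EF).
have H2 : (L E <= (\sum_(j in J) C * 22 ^+ n.+2 * sigma j ^+ n.+2)%:E)%E.
  apply: le_trans H1 _; rewrite [X in X%:E]big_mkcond -sumEFin; apply: lee_sum => j _.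
  rewrite /F'; case: ifPn => jJ; last by rewrite measure0.
  apply: le_trans (HC _ _ (Bw j) _) _; first by rewrite mulr_gt0// J0.
  by rewrite exprMn mulrA.
move: H2; rewrite -volK// lee_fin => H2.
apply: (@le_trans _ _ (\sum_(j in J) C * 22 ^+ n.+2 * (lambda * sigma j ^+ n.+2))).
  apply: le_trans (ler_wpM2l (ltW l0) H2) _; rewrite le_eqVlt; apply/orP; left.
  by apply/eqP; rewrite mulr_sumr; apply: eq_bigr => j _; rewrite mulrCA.
rewrite -mulr_sumr; apply: ler_wpM2l; first by apply: mulr_ge0 => //; exact: exprn_ge0.
apply: (@le_trans _ _ (\sum_(j in J) \sum_(k in N j) m k)).
  apply: ler_sum => j /J0 /Hs; congr (_ <= _).
  by apply: eq_bigl => k; rewrite finset.inE.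
(* By disjointness each index [k] lies in at most one [N j]. *)
rewrite (exchange_big_dep xpredT)//=; apply: ler_sum => k _.
rewrite sumr_const; have [c0|] := posnP #|[pred j in J | k \in N j]|.
  by rewrite (eq_card (B := [pred j in J | k \in N j]))// c0 mulr0n.
move=> /card_gt0P[j0]; rewrite unfold_in => /andP[j0J kj0].
rewrite (eq_card (B := pred1 j0)) ?card1 ?mulr1n// => j; rewrite [RHS]inE unfold_in.
apply/idP/eqP => [/andP[jJ kj]|->]; last by rewrite j0J.
apply: contrapT => /eqP jj0.
have /setP/(_ k) := Jd _ _ jJ j0J jj0.
by rewrite finset.in_setI finset.in_set0 kj kj0.
Qed.

End bad_set.

(** * Critical exponent: Carleson measures *)

Section carleson.
Variables (R : realType) (n : nat).
Notation V := (n.+1.-tuple R[i]).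
Notation B := (unit_ball R n.+1).
Notation L := (lebesgue_Cd R n.+1).
Notation N := (n.+2%:R : R).

(** The point is p = (1 - t) w. Since 1 - t <= |w|^2 <= 1, its depth 1 - (1 - t)^2 |w|^2 lies
    between t and 3t, and q(p,w) = 1 - (1 - t)|w|^2 <= 2t. *)
Lemma radial_shrink (w : V) (t : R) : B w -> defect w <= t -> t <= 1 ->
  exists p : V, [/\ B p, t <= defect p <= 3 * t & qdist p w <= 2 * t].
Proof.
move=> /unit_ballE w0 wt t1.
pose p : V := [tuple Complex (1 - t) 0 * tnth w i | i < n.+1].
have pE : defect p = 1 - (1 - t) ^+ 2 * (1 - defect w).
  rewrite /defect opprB [X in _ * X]addrC subrK mulr_sumr; congr (_ - _).
  apply: eq_bigr => i _.
  by rewrite tnth_mktuple cmodM cmod_real exprMn real_normK ?num_real.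
have qE : 1 - cdot p w = Complex (1 - (1 - t) * (1 - defect w)) 0.
  have -> : cdot p w = Complex (1 - t) 0 * cdot w w.
    by rewrite /cdot mulr_sumr; apply: eq_bigr => i _; rewrite tnth_mktuple mulrA.
  by rewrite cdot_self; apply/eqP; rewrite eq_complex/=; apply/andP; split; apply/eqP; ring.
have a0 : 0 <= 1 - t by lra.
have a2b : (1 - t) ^+ 2 * (1 - defect w) <= (1 - t) ^+ 2.
  by rewrite ler_piMr ?sqr_ge0//; lra.
have a3 : (1 - t) ^+ 2 * (1 - t) <= (1 - t) ^+ 2 * (1 - defect w).
  by rewrite ler_wpM2l ?sqr_ge0//; lra.
have H : t <= defect p <= 3 * t by rewrite pE; apply/andP; split; nra.
have ab : (1 - t) * (1 - t) <= (1 - t) * (1 - defect w) by rewrite ler_wpM2l//; lra.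
have ab1 : (1 - t) * (1 - defect w) <= 1 by rewrite mulr_ile1//; lra.
exists p; split => //; first by apply/unit_ballE; lra.
rewrite /qdist qE cmod_real ger0_norm; nra.
Qed.

(** Carleson condition in averaged form: if each m_i is spread uniformly over the tent of p_i, whose
    volume is comparable to defect u ^ (n+2) for every u in it, the resulting density is O(M). *)
Definition carleson_bound (I : finType) (p : I -> V) (m : I -> R) (M : R) :=
  forall u, B u -> \sum_(i | u \in tent (p i)) m i <= M * defect u ^+ n.+2.

(** Seen from z, a tent is no wider than its distance: q(p,u) <= 2 defect p <= 4 q(p,z), whence 15 =
    3 (1 + 4). The kernel at p is thus dominated by the kernel at every point of the tent. *)
Lemma tent_kernel_le (p z u : V) : B p -> B z -> tent p u ->
  [/\ qdist z u <= 15 * qdist p z, defect u <= 4 * defect p & 0 < defect u].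
Proof.
move=> Bp Bz [[Bu /= up] pu]; split; last exact/unit_ballE.
  have := qdist_triangle Bz Bp Bu; rewrite (qdistC z p) (qdistC p u).
  by have := defect_le_qdist p Bz; lra.
by have := defect_le_qdist u Bp; lra.
Qed.

(** Each term is at most its analogue averaged over the tent of p_i. After exchanging sum and
    integral the Carleson condition removes the masses, and the Forelli-Rudin integral remains. *)
Lemma carleson_potential_le : exists2 C : R, 0 < C &
  forall (I : finType) (p : I -> V) (m : I -> R) M z,
  (forall i, B (p i)) -> (forall i, 0 <= m i) -> 0 <= M -> carleson_bound p m M ->
  B z ->
  \sum_i m i * qdist (p i) z `^ (- N) * defect (p i) `^ (- 2^-1) <=
    C * M * defect z `^ (- 2^-1).
Proof.
have [c c0 Hc] := tent_measure_ge R n; have [A A0 HA] := forelli_rudin R n.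
pose K := 15 `^ N * 4 `^ 2^-1 * 4 `^ N / c.
have K0 : 0 < K by rewrite divr_gt0// !mulr_gt0// powR_gt0.
(* [A + 1] instead of [A] makes the constant positive; [carleson_weak_type] divides by it. *)
exists (K * (A + 1)); first by rewrite mulr_gt0// ltr_wpDl.
move=> I p m M z Bp m0 M0 carl Bz; have /unit_ballE z0 := Bz.
pose hk u := defect u `^ (- 2^-1) * qdist z u `^ (- N).
pose X u := defect u `^ (- N) * hk u.
have hk0 u : 0 <= hk u by rewrite mulr_ge0 ?powR_ge0.
have X0 u : 0 <= X u by rewrite mulr_ge0 ?powR_ge0.
have md a : measurable_fun setT (fun u : V => defect u `^ a).
  exact: (measurableT_comp (measurable_powR _) (@measurable_defect R _)).
have mhk : measurable_fun setT hk.
  by apply: measurable_funM => //; exact: measurable_kernel.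
have mX : measurable_fun setT X by exact: measurable_funM.
have mB : measurable B by exact: measurable_unit_ball.
have tB i : tent (p i) `<=` B by move=> u [[]].
pose G i := (fun u => (m i * K * X u)%:E) \_ (tent (p i)).
have G0 i u : (0 <= G i u)%E.
  by rewrite /G patchE; case: ifP => // _; rewrite lee_fin mulr_ge0// mulr_ge0// ltW.
have mg i : measurable_fun setT (fun u => (m i * K * X u)%:E).
  by apply/measurable_EFinP; exact: measurable_funM.
have mG i : measurable_fun B (G i).
  apply: measurable_funTS; apply/(measurable_restrictT _ _).1.
    exact: measurable_tent.
  exact: measurable_funTS.
have step i : ((m i * qdist (p i) z `^ (- N) * defect (p i) `^ (- 2^-1))%:E <=
    \int[L]_(u in B) G i u)%E.
  have /unit_ballE pi0 := Bp i; set t := defect (p i) in pi0 *.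
  have ctn : 0 < c * t ^+ n.+2 by rewrite mulr_gt0// exprn_gt0.
  set a := _ * t `^ _.
  have a0 : 0 <= a by rewrite !mulr_ge0 ?powR_ge0.
  rewrite -(divfK (lt0r_neq0 ctn) a) EFinM.
  apply: (@le_trans _ _ ((a / (c * t ^+ n.+2))%:E * L (tent (p i)))%E).
    apply: lee_wpmul2l; first by rewrite lee_fin divr_ge0// ltW.
    exact: Hc.
  rewrite -integral_cst; last exact: measurable_tent.
  rewrite -integral_mkcondr setIidr//.
  apply: ge0_le_integral => //.
  - exact: measurable_tent.
  - by move=> u _; rewrite lee_fin divr_ge0// ltW.
  - exact: measurable_funTS.
  move=> u tu; rewrite lee_fin.
  have [qu du u0] := tent_kernel_le (Bp i) Bz tu.
  have Bu := tB _ _ tu.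
  have q15 : qdist (p i) z `^ (- N) <= 15 `^ N * qdist z u `^ (- N).
    by apply: powRN_le; rewrite ?qdist_gt0.
  have t4 e : 0 <= e -> t `^ (- e) <= 4 `^ e * defect u `^ (- e).
    by move=> e0; apply: powRN_le.
  have tN : (t ^+ n.+2)^-1 = t `^ (- N) by rewrite powRN powR_mulrn ?(ltW pi0).
  rewrite /a invfM tN.
  rewrite (_ : m i * _ * _ * _ = m i / c *
    (qdist (p i) z `^ (- N) * (t `^ (- 2^-1) * t `^ (- N)))); last by ring.
  rewrite (_ : m i * K * X u = m i / c * ((15 `^ N * qdist z u `^ (- N)) *
    ((4 `^ 2^-1 * defect u `^ (- 2^-1)) * (4 `^ N * defect u `^ (- N))))); last first.
    by rewrite /K /X /hk; ring.
  apply: ler_wpM2l; first by rewrite divr_ge0// ltW.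
  apply: ler_pM => //; rewrite ?powR_ge0 ?mulr_ge0 ?powR_ge0//.
  by apply: ler_pM; rewrite ?powR_ge0// t4.
rewrite -lee_fin -sumEFin.
apply: (@le_trans _ _ (\int[L]_(u in B) \sum_i G i u)%E).
  rewrite ge0_integral_sum//; apply: lee_sum => i _; exact: step.
apply: (@le_trans _ _ (\int[L]_(u in B) ((K * M)%:E * (hk u)%:E))%E).
  apply: ge0_le_integral => //.
  - by move=> u _; exact: sume_ge0.
  - exact: emeasurable_sum.
  - by apply: emeasurable_funM => //; apply: measurable_funTS; apply/measurable_EFinP.
  - move=> u Bu; have /unit_ballE u0 := Bu.
    rewrite (eq_bigr (fun i =>
      (K * X u * (if u \in tent (p i) then m i else 0))%:E)); last first.
      by move=> i _; rewrite /G patchE; case: ifP => _; [congr EFin; ring|rewrite mulr0].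
    rewrite sumEFin -mulr_sumr -big_mkcond/= -EFinM lee_fin.
    apply: (@le_trans _ _ (K * X u * (M * defect u ^+ n.+2))).
      by apply: ler_wpM2l; [rewrite mulr_ge0// ltW|exact: carl].
    rewrite /X powRN powR_mulrn ?(ltW u0)// le_eqVlt; apply/orP; left; apply/eqP.
    by field; rewrite expf_neq0// gt_eqF.
rewrite ge0_integralZl_EFin//; last 3 first.
- by move=> u _; rewrite lee_fin.
- by apply: measurable_funTS; apply/measurable_EFinP.
- by rewrite mulr_ge0// ltW.
apply: (@le_trans _ _ ((K * M)%:E * (A * defect z `^ (- 2^-1))%:E)%E).
  by apply: lee_wpmul2l; [rewrite lee_fin mulr_ge0// ltW|exact: HA].
rewrite -EFinM lee_fin.
have := powR_ge0 (defect z) (- 2^-1); set y := defect z `^ _ => y0.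
rewrite (_ : K * (A + 1) * M * y = K * M * (A * y) + K * M * y); last by ring.
by rewrite lerDl; apply: mulr_ge0 => //; exact: mulr_ge0 (ltW K0) M0.
Qed.

(* AM-GM with weight [defect z ^ (1/2)] splits the kernel between
   carleson_potential_le and a term integrated by forelli_rudin. *)
Lemma carleson_weak_type (kappa : R) : 0 < kappa -> exists2 C : R, 0 <= C &
  forall (I : finType) (p : I -> V) (m : I -> R) M (E : set V),
  (forall i, B (p i)) -> (forall i, 0 <= m i) -> 0 < M -> carleson_bound p m M ->
  measurable E -> E `<=` B ->
  (forall z, E z -> kappa * M <= \sum_i m i * qdist (p i) z `^ (- N)) ->
  M * vol E <= C * \sum_i m i.
Proof.
move=> k0; have [C C0 HC] := carleson_potential_le.
have [A A0 HA] := forelli_rudin R n.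
(* Chosen so that the first AM-GM term, bounded by [carleson_potential_le], is at most kappa M. As
   twice the potential is at least 2 kappa M, the second term must be at least kappa M. *)
pose eps := kappa / C.
have eps0 : 0 < eps by rewrite divr_gt0.
exists (A / (eps * kappa)); first by rewrite divr_ge0// ltW// mulr_gt0.
move=> I p m M E Bp m0 M0 carl mE EB HE.
(* The two weights are opposite powers, so by [forelli_rudin] the integral of [F i] over the ball is
   at most A, uniformly in i. *)
pose F i z := defect (p i) `^ 2^-1 * (defect z `^ (- 2^-1) * qdist (p i) z `^ (- N)).
have := @chebyshev_sum _ _ _ L I E (eps * kappa * M) m (fun=> A) F mE _ m0 _ _ _ _.
rewrite [X in (_ * X <= _)%E](_ : _ = (vol E)%:E); last exact/esym/volK.
rewrite -EFinM lee_fin -mulr_suml => H.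
have {}H : eps * kappa * M * vol E <= (\sum_i m i) * A.
  apply: H.
  - exact: ltW (mulr_gt0 (mulr_gt0 eps0 k0) M0).
  - move=> i; apply: measurable_funM => //; apply: measurable_funM.
      exact: (measurableT_comp (measurable_powR _) (@measurable_defect R _)).
    exact: measurable_kernel.
  - by move=> i z; rewrite !mulr_ge0 ?powR_ge0.
  - move=> z Ez; have Bz := EB _ Ez; have /unit_ballE z0 := Bz.
    pose y := defect z `^ 2^-1; have y0 : 0 < y by rewrite powR_gt0.
    have yV : defect z `^ (- 2^-1) = y^-1 by rewrite powRN.
    have H1 := HC I p m M z Bp m0 (ltW M0) carl Bz.
    have H2 : (\sum_i m i * qdist (p i) z `^ (- N)) *+ 2 <=
        eps * y * (\sum_i m i * qdist (p i) z `^ (- N) * defect (p i) `^ (- 2^-1)) +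
        eps^-1 * (\sum_i m i * F i z).
      rewrite -sumrMnl !mulr_sumr -big_split/=; apply: ler_sum => i _.
      have /unit_ballE pi0 := Bp i.
      rewrite /F yV; set x := defect (p i) `^ 2^-1.
      have x0 : 0 < x by rewrite powR_gt0.
      have -> : defect (p i) `^ (- 2^-1) = x^-1 by rewrite powRN.
      set k := qdist _ _ `^ _; have mk : 0 <= m i * k by rewrite mulr_ge0 ?powR_ge0.
      pose b := eps * y / x; have b0 : 0 < b by rewrite divr_gt0// mulr_gt0.
      rewrite [leRHS](_ : _ = m i * k * (b + b^-1)); last first.
        by rewrite /b; field; rewrite !gt_eqF.
      rewrite -mulr_natr; apply: ler_wpM2l => //.
      have : b * b^-1 = 1 by rewrite divff// gt_eqF.
      have : 0 < b^-1 by rewrite invr_gt0.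
      by move: (b^-1) => b' b'0 bb'; have := sqr_ge0 (b - b'); nra.
    move: H2; have := HE _ Ez; set Q := \sum_i _.
    set S := \sum_i _ in H1 *; set T := \sum_i _.
    move=> Q1 Q2.
    have H3 : eps * y * S <= kappa * M.
      apply: (@le_trans _ _ (eps * y * (C * M * defect z `^ (- 2^-1)))).
        by apply: ler_wpM2l H1; exact: ltW (mulr_gt0 eps0 y0).
      rewrite yV le_eqVlt; apply/orP; left; apply/eqP.
      by rewrite /eps; field; rewrite !gt_eqF.
    have H4 : kappa * M <= eps^-1 * T by move: Q2; rewrite mulr2n; lra.
    by rewrite -mulrA; move: H4; rewrite [eps^-1 * _]mulrC ler_pdivlMr// mulrC.
  - move=> i; have /unit_ballE pi0 := Bp i.
    apply: (@le_trans _ _ (\int[L]_(z in B) (F i z)%:E)%E).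
      apply: ge0_subset_integral => //.
      + exact: measurable_unit_ball.
      + apply: measurable_funTS; apply/measurable_EFinP.
        apply: measurable_funM => //; apply: measurable_funM.
          exact: (measurableT_comp (measurable_powR _) (@measurable_defect R _)).
        exact: measurable_kernel.
      + by move=> z _; rewrite lee_fin !mulr_ge0 ?powR_ge0.
    under eq_integral do rewrite EFinM.
    rewrite ge0_integralZl_EFin ?powR_ge0//; last 3 first.
    + exact: measurable_unit_ball.
    + by move=> z _; rewrite lee_fin !mulr_ge0 ?powR_ge0.
    + apply: measurable_funTS; apply/measurable_EFinP; apply: measurable_funM.
        exact: (measurableT_comp (measurable_powR _) (@measurable_defect R _)).
      exact: measurable_kernel.
    apply: (@le_trans _ _ ((defect (p i) `^ 2^-1)%:E *
        (A * defect (p i) `^ (- 2^-1))%:E)%E).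
      by apply: lee_wpmul2l; [rewrite lee_fin powR_ge0|exact: HA].
    rewrite -EFinM lee_fin mulrCA -powRD ?(gt_eqF pi0) ?implybT//.
    by rewrite subrr powRr0 mulr1.
have ek : 0 < eps * kappa by rewrite mulr_gt0.
rewrite mulrAC ler_pdivlMr//; move: H; lra.
Qed.

End carleson.

(** * The weak-type estimate for point masses *)

Section weak_type.
Variables (R : realType) (n : nat).
Notation V := (n.+1.-tuple R[i]).
Notation B := (unit_ball R n.+1).
Notation L := (lebesgue_Cd R n.+1).
Notation N := (n.+2%:R : R).

(** If u is in the tent of p_i, then t_i <= 2 defect u and q(u, w_i) <= 3 (4 + 4) defect u. Two such
    sources are thus within 144 defect u of each other, so a single q-ball about one of them, of
    radius 145 defect u >= 2 sigma, captures all these masses, and its mass is below the stopping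
    threshold. *)
Lemma stopping_carleson (I : finType) (w p : I -> V) (m sigma t : I -> R) lambda :
  (forall i, B (w i)) -> (forall i, 0 <= m i) -> 0 < lambda ->
  (forall i s, 0 < s -> 2 * sigma i <= s ->
    \sum_(k | qdist (w i) (w k) < s) m k < lambda * s ^+ n.+2) ->
  (forall i, sigma i <= t i) ->
  (forall i, [/\ B (p i), t i <= defect (p i) & qdist (p i) (w i) <= 2 * t i]) ->
  carleson_bound p m (lambda * 145 ^+ n.+2).
Proof.
move=> Bw m0 l0 Hs st Hp u Bu; have /unit_ballE u0 := Bu.
have near i : u \in tent (p i) -> t i <= 2 * defect u /\ qdist u (w i) <= 24 * defect u.
  move=> /set_mem[[_ /= up] pu]; have [Bp tp pw] := Hp i.
  have := qdist_triangle Bu Bp (Bw i); lra.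
have [i0 ui0|none] := pickP (fun i => u \in tent (p i)); last first.
  rewrite big_pred0//; apply: mulr_ge0; last exact/exprn_ge0/ltW.
  by apply: mulr_ge0 (ltW l0) _; exact: exprn_ge0.
have [ti0 wi0] := near _ ui0; have si0 := st i0.
rewrite -mulrA -exprMn; apply: le_trans (ltW (Hs i0 (145 * defect u) _ _)); last 2 first.
- by rewrite mulr_gt0.
- by lra.
rewrite big_mkcond [leRHS]big_mkcond; apply: ler_sum => i _.
case: ifPn => [/near[_ wi]|_]; last by case: ifP.
rewrite ifT//; have := qdist_triangle (Bw i0) Bu (Bw i).
by rewrite (qdistC (w i0) u); lra.
Qed.

Lemma weak_type_critical : exists2 C : R, 0 <= C &
  forall (I : finType) (w : I -> V) (m : I -> R) lambda,
  (forall i, B (w i)) -> (forall i, 0 <= m i) -> 0 < lambda ->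
  lambda * vol (superlevel w m N lambda) <= C * \sum_i m i.
Proof.
have [C1 C10 H1] := bad_set_measure_le R n.
pose c15 : R := 15 `^ N; pose c145 : R := 145 ^+ n.+2.
have c15_gt0 : 0 < c15 by exact: powR_gt0.
have c145_ge1 : 1 <= c145 by apply: exprn_ege1; rewrite ler1n.
have c145_gt0 : 0 < c145 by lra.
(* The moved masses have Carleson constant lambda c145, and moving them divides the potential by at
   most c15, so the level to be tested is lambda / c15 = kappa (lambda c145). *)
pose kappa := (c15 * c145)^-1.
have kappa0 : 0 < kappa by rewrite invr_gt0 mulr_gt0.
have [C2 C20 H2] := carleson_weak_type n kappa0.
exists (vol B + C1 + C2).
  by apply: addr_ge0 => //; apply: addr_ge0 => //; exact: vol_ge0.
move=> I w m lambda Bw m0 l0; set E := superlevel _ _ _ _.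
have mE : measurable E by exact: measurable_superlevel.
have EB : E `<=` B by move=> z [].
have mB : measurable B by exact: measurable_unit_ball.
have M0 : 0 <= \sum_i m i by exact: sumr_ge0.
(* A total mass of at least lambda is settled by the volume of the ball. Otherwise all stopping
   radii are below 1, which keeps t_i <= 1 in [radial_shrink]. *)
have [lM|Ml] := leP lambda (\sum_i m i).
  apply: (@le_trans _ _ (\sum_i m i * vol B)); last first.
    rewrite -mulr_suml mulrC ler_wpM2r//.
    by rewrite -addrA lerDl addr_ge0.
  rewrite -mulr_suml; apply: ler_pM => //; [exact: ltW|exact: vol_ge0|].
  by rewrite -lee_fin !volK//; apply: le_measure; rewrite ?inE.
have [sigma Hsigma] := stopping_radii w m0 Ml.
pose t i := Num.max (sigma i) (defect (w i)).
have Hp i : exists p : V, [/\ B p, t i <= defect p <= 3 * t i & qdist p (w i) <= 2 * t i].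
  apply: radial_shrink => //; first by rewrite /t le_max lexx orbT.
  rewrite /t ge_max defect_le1 andbT.
  by have [/andP[_ /ltW]] := Hsigma i.
have [p {}Hp] := choice Hp.
have carl : carleson_bound p m (lambda * c145).
  apply: (stopping_carleson (w := w) (sigma := sigma) (t := t)) => //.
  - by move=> i s; have [_ _] := Hsigma i; apply.
  - by move=> i; rewrite /t le_max lexx.
  - by move=> i; have [? /andP[? _] ?] := Hp i.
pose U := \big[setU/set0]_i [set z | qdist (w i) z < sigma i].
have mU : measurable U.
  apply: bigsetU_measurable => i _; apply: measurable_lt; exact: measurable_qdist.
have UP z : U z <-> exists i, qdist (w i) z < sigma i.
  rewrite /U -bigcup_seq; split; first by case=> i _ zi; exists i.
  by case=> i zi; exists i => //=; rewrite mem_index_enum.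
have mEU : measurable (E `&` U) by exact: measurableI.
have mED : measurable (E `\` U) by exact: measurableD.
have volE : vol E <= vol (E `&` U) + vol (E `\` U).
  rewrite -lee_fin EFinD !volK//; try by move=> z [/EB].
  rewrite -[in leLHS](setUIDK E U).
  exact: measureU2.
have bad : lambda * vol (E `&` U) <= C1 * \sum_i m i.
  apply: (H1 I w m sigma) => //.
  - by move=> z [/EB].
  - by move=> i; have [_ + _] := Hsigma i.
  - by move=> z [_ /UP].
have good : lambda * c145 * vol (E `\` U) <= C2 * \sum_i m i.
  apply: (H2 I p m) => //.
  - by move=> i; have [] := Hp i.
  - by rewrite mulr_gt0.
  - by move=> z [/EB].
  move=> z [[Bz /= Ez] Uz].
  rewrite (_ : kappa * _ = lambda / c15); last first.
    by rewrite /kappa; field; rewrite !gt_eqF.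
  rewrite ler_pdivrMr//; apply: le_trans (ltW Ez) _.
  rewrite mulr_suml; apply: ler_sum => i _; rewrite -mulrA; apply: ler_wpM2l => //.
  rewrite mulrC; have [Bp tp pw] := Hp i.
  apply: powRN_le; rewrite ?qdist_gt0//.
  have sz : sigma i <= qdist (w i) z.
    by rewrite leNgt; apply/negP => sz; apply: Uz; apply/UP; exists i.
  (* Only here is it used that z avoids the stopping balls. Then q(p_i, z) <= 3 (2 t_i + q(w_i, z))
     <= 15 q(w_i, z). *)
  have tz : t i <= 2 * qdist (w i) z.
    rewrite /t ge_max defect_le_qdist// andbT.
    by have := qdist_ge0 (w i) z; lra.
  by have := qdist_triangle Bp (Bw i) Bz; lra.
have good' : lambda * vol (E `\` U) <= C2 * \sum_i m i.
  apply: le_trans good; rewrite ler_wpM2r ?vol_ge0//.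
  by rewrite ler_peMr// ltW.
apply: (@le_trans _ _ ((C1 + C2) * \sum_i m i)).
  rewrite mulrDl; apply: le_trans (lerD bad good').
  by rewrite -mulrDr ler_wpM2l// ltW.
by rewrite ler_wpM2r// -addrA lerDr vol_ge0.
Qed.

Lemma weak_type_discrete (alpha : R) : 0 < alpha <= N -> exists2 C : R, 0 <= C &
  forall (I : finType) (w : I -> V) (m : I -> R) lambda,
  (forall i, B (w i)) -> (forall i, 0 <= m i) -> 0 < lambda ->
  lambda * vol (superlevel w m alpha lambda) `^ (alpha / N) <= C * \sum_i m i.
Proof.
move=> /andP[al0]; rewrite le_eqVlt => /orP[/eqP->|alN]; last first.
  by apply: weak_type_subcritical; rewrite al0.
have [C C0 HC] := weak_type_critical; exists C => // I w m lambda Bw m0 l0.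
by rewrite divff ?pnatr_eq0// powRr1 ?vol_ge0//; exact: HC.
Qed.

End weak_type.

(** * From point masses to integrable densities *)

Section discretization.
Variables (R : realType) (n : nat).
Notation V := (n.+1.-tuple R[i]).
Notation B := (unit_ball R n.+1).
Notation L := (lebesgue_Cd R n.+1).
Notation N := (n.+2%:R : R).

Lemma unit_ball0 : B [tuple (0 : R[i]) | i < n.+1].
Proof.
rewrite /unit_ball/= big1// => j _.
by rewrite tnth_mktuple cmod0 expr0n.
Qed.

Lemma small_partition (eta : R) : 0 < eta ->
  exists (I : finType) (F : I -> set V), [/\ forall c, measurable (F c),
    forall c, F c `<=` B, forall z, B z -> exists c, F c z,
    forall c c' z, F c z -> F c' z -> c = c' &
    forall c z z', F c z -> F c z' ->
      \sum_(j < n.+1) cmod (tnth z j - tnth z' j) <= n.+1%:R * (2 * eta)].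
Proof.
(* Real and imaginary parts lie in [-1, 1], of length 2, so [K] half-open intervals of length eta
   cover them. *)
move=> eta0; pose K := Num.bound (2 / eta).
have HK : 2 / eta < K%:R by apply: archi_boundP; rewrite divr_ge0// ltW.
pose f (x : R) := (x + 1) / eta.
pose J (k : nat) : set (measurableTypeR R) :=
  `[k%:R * eta - 1, k.+1%:R * eta - 1[%classic.
have JP (k : nat) x : J k x <-> k%:R <= f x < k.+1%:R.
  rewrite /J/= in_itv/= /f ler_pdivlMr// ltr_pdivrMr//.
  by rewrite lerBlDr ltrBrDr.
have Juniq k k' x : J k x -> J k' x -> k = k'.
  move=> /JP/andP[a b] /JP/andP[a' b']; apply/eqP; rewrite eqn_leq.
  by apply/andP; split; rewrite -ltnS -(ltr_nat R);
    [exact: le_lt_trans a b'|exact: le_lt_trans a' b].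
have Jex x : `|x| <= 1 -> exists k : 'I_K, J k x.
  rewrite ler_norml => /andP[x1 x2].
  have fx0 : 0 <= f x by rewrite divr_ge0 ?(ltW eta0)//; lra.
  have /andP[k1 k2] := truncn_itv fx0.
  have kK : (Num.truncn (f x) < K)%N.
    rewrite -(ltr_nat R); apply: le_lt_trans k1 _; apply: le_lt_trans HK.
    by rewrite ler_pM2r ?invr_gt0//; lra.
  by exists (Ordinal kK); apply/JP; rewrite k1.
have Jd k x x' : J k x -> J k x' -> `|x - x'| <= eta.
  rewrite /J/= !in_itv/= -natr1 mulrDl mul1r => /andP[a b] /andP[a' b'].
  by rewrite ler_norml; apply/andP; split; lra.
pose Q (c : 'I_K * 'I_K) : set R[i] := [set x | J c.1 (complex.Re x) /\ J c.2 (complex.Im x)].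
have mQ c : measurable (Q c) by apply: measurable_complex_rect; exact: measurable_itv.
pose F (c : {ffun 'I_n.+1 -> 'I_K * 'I_K}) : set V :=
  B `&` [set z | forall j, Q (c j) (tnth z j)].
exists {ffun 'I_n.+1 -> 'I_K * 'I_K}, F; split.
- move=> c; apply: measurableI; first exact: measurable_unit_ball.
  exact: (measurable_tuple_box (fun j => mQ (c j))).
- by move=> c z [].
- move=> z Bz.
  have Hj j : exists c, Q c (tnth z j).
    have zj := cmod_le1 j Bz.
    have [k1 Hk1] := Jex _ (le_trans (Re_le_cmod _) zj).
    have [k2 Hk2] := Jex _ (le_trans (Im_le_cmod _) zj).
    by exists (k1, k2).
  have [c Hc] := choice Hj.
  by exists [ffun j => c j]; split => //= j; rewrite ffunE.
- move=> c c' z [_ /= Hc] [_ /= Hc']; apply/ffunP => j.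
  have [a b] := Hc j; have [a' b'] := Hc' j.
  rewrite [c j]surjective_pairing [c' j]surjective_pairing.
  by congr pair; apply/val_inj; [exact: Juniq a a'|exact: Juniq b b'].
- move=> c z z' [_ /= Hz] [_ /= Hz'].
  apply: (@le_trans _ _ (\sum_(j < n.+1) 2 * eta)).
    apply: ler_sum => j _; apply: le_trans (cmod_le_ReIm _) _.
    have [a b] := Hz j; have [a' b'] := Hz' j.
    by rewrite ReB ImB mulr2n mulrDl mul1r lerD// (Jd _ _ _ a a', Jd _ _ _ b b').
  by rewrite sumr_const card_ord -[leLHS]mulr_natl.
Qed.

(* On [{z | delta <= defect z}] the kernel is comparable to a constant on each
   piece of a fine enough partition, which reduces the claim to point masses. *)
Lemma weak_type_truncated (alpha : R) : 0 < alpha <= N -> exists2 C : R, 0 <= C &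
  forall (phi : V -> R) (F : R) (E : set V) lambda delta,
  measurable_fun B phi -> (forall z, 0 <= phi z) ->
  (\int[L]_(w in B) (phi w)%:E = F%:E)%E ->
  measurable E -> E `<=` B -> 0 < lambda -> 0 < delta ->
  (forall z, E z -> delta <= defect z) ->
  (forall z, E z ->
    (lambda%:E < \int[L]_(w in B) (phi w * qdist w z `^ (- alpha))%:E)%E) ->
  lambda * vol E `^ (alpha / N) <= C * F.
Proof.
move=> al; have [C C0 HC] := weak_type_discrete al; have /andP[al0 _] := al.
have p2 : 0 < 2 `^ alpha :> R by exact: powR_gt0.
exists (C * 2 `^ alpha); first by rewrite mulr_ge0// ltW.
move=> phi F E lambda delta mphi phi0 phiF mE EB l0 d0 Ed EU.
have n0 : 0 < n.+1%:R :> R by [].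
(* Then w_c and u in the same cell satisfy q(w_c, z) <= q(u, z) + delta / 2 <= 2 q(u, z), since
   delta <= defect z <= 2 q(u, z). This is the origin of the factor 2^alpha. *)
pose eta : R := delta / (4 * n.+1%:R).
have eta0 : 0 < eta by rewrite divr_gt0// mulr_gt0.
have [I [P [mP PB Pcov Pu Pd]]] := small_partition eta0.
have etaE : n.+1%:R * (2 * eta) = delta / 2.
  by rewrite /eta; field; rewrite gt_eqF.
(* An empty cell is given the origin as its point; its mass is 0. *)
have Pw c : exists p, B p /\ (P c !=set0 -> P c p).
  have [[p Pp]|Pc0] := pselect (P c !=set0); first by exists p; split => //; exact: PB Pp.
  by exists [tuple (0 : R[i]) | i < n.+1]; split => //; exact: unit_ball0.
have [w Hw] := choice Pw.
have mB : measurable B by exact: measurable_unit_ball.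
have BP : B = \big[setU/set0]_c P c.
  rewrite -bigcup_seq; apply/seteqP; split => z.
    by move=> /Pcov[c Pc]; exists c => //=; rewrite mem_index_enum.
  by move=> [c _ /PB].
have tP : trivIset [set` index_enum I] P.
  by apply/trivIsetP => c c' _ _ cc'; apply/seteqP; split => // z [Pz Pz'];
    move: cc'; rewrite (Pu _ _ _ Pz Pz') eqxx.
have intB (f : V -> \bar R) : measurable_fun B f -> (forall z, 0 <= f z)%E ->
    (\int[L]_(z in B) f z = \sum_c \int[L]_(z in P c) f z)%E.
  move=> mf f0; rewrite [in LHS]BP ge0_integral_bigsetU//.
  - exact: index_enum_uniq.
  - by rewrite -BP.
have mphiE : measurable_fun B (fun z => (phi z)%:E) by exact/measurable_EFinP.
have intc c : (\int[L]_(z in P c) (phi z)%:E)%E \is a fin_num.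
  rewrite ge0_fin_numE; last by apply: integral_ge0 => z _; rewrite lee_fin.
  apply: (@le_lt_trans _ _ (\int[L]_(z in B) (phi z)%:E)%E); last by rewrite phiF ltry.
  by apply: ge0_subset_integral => //; move=> z _; rewrite lee_fin.
pose m c := fine (\int[L]_(z in P c) (phi z)%:E)%E.
have m0 c : 0 <= m c by rewrite fine_ge0// integral_ge0// => z _; rewrite lee_fin.
have mE' c : ((m c)%:E = \int[L]_(z in P c) (phi z)%:E)%E by rewrite /m fineK.
have sm : \sum_c m c = F.
  apply/eqP; rewrite -eqe -sumEFin -phiF intB//.
  by apply/eqP; apply: eq_bigr => c _; rewrite mE'.
have EP : E `<=` superlevel w m alpha (lambda / 2 `^ alpha).
  move=> z Ez; have Bz := EB _ Ez; split => //=.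
  rewrite ltr_pdivrMr// -lte_fin; apply: lt_le_trans (EU _ Ez) _.
  have mk : measurable_fun B (fun w => (phi w * qdist w z `^ (- alpha))%:E).
    apply/measurable_EFinP; apply: measurable_funM => //; apply: measurable_funTS.
    have := @measurable_kernel R n z (- alpha).
    by congr measurable_fun; apply/funext => u; rewrite qdistC.
  rewrite intB//; last by move=> u; rewrite lee_fin mulr_ge0 ?powR_ge0.
  rewrite /potential mulr_suml -sumEFin; apply: lee_sum => c _.
  have [Pc0|Pc0] := pselect (P c !=set0); last first.
    have -> : P c = set0 by apply/seteqP; split => // u Pu'; apply: Pc0; exists u.
    by rewrite integral_set0 lee_fin !mulr_ge0 ?powR_ge0.
  have Pcw := (Hw c).2 Pc0.
  rewrite -mulrA EFinM mE' -ge0_integralZr//; last 3 first.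
  - exact: measurable_funS mphiE.
  - by move=> u _; rewrite lee_fin.
  - by rewrite lee_fin mulr_ge0 ?powR_ge0.
  apply: ge0_le_integral => //.
  - by move=> u _; rewrite lee_fin mulr_ge0 ?powR_ge0.
  - exact: measurable_funS mk.
  - by apply: emeasurable_funM => //; exact: measurable_funS mphiE.
  move=> u Pcu; rewrite -EFinM lee_fin; apply: ler_wpM2l => //.
  have Bu := PB _ _ Pcu; have Bw := (Hw c).1.
  rewrite mulrC; apply: powRN_le; rewrite ?qdist_gt0 ?(ltW al0)//.
  have := qdist_lip (w c) u Bz; have := Pd _ _ _ Pcw Pcu; rewrite etaE.
  have := defect_le_qdist z Bu; have := Ed _ Ez.
  by rewrite (qdistC u z) (qdistC (w c) z); lra.
have l2 : 0 < lambda / 2 `^ alpha by rewrite divr_gt0.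
have := HC I w m _ (fun c => (Hw c).1) m0 l2; rewrite sm mulrAC ler_pdivrMr//.
rewrite mulrAC; apply: le_trans; apply: ler_wpM2l; first exact: ltW.
apply: ge0_ler_powR; rewrite ?nnegrE ?vol_ge0 ?divr_ge0 ?(ltW al0)//.
rewrite -lee_fin !volK//; [|exact: measurable_superlevel|by move=> z []].
by apply: le_measure; rewrite ?inE//; exact: measurable_superlevel.
Qed.

(** The truncated constant does not depend on delta, so E is exhausted by its parts of depth at
    least 1 / (k+1). The estimate is first solved for the volume, to which continuity from below
    applies. *)
Lemma weak_type_integral (alpha : R) : 0 < alpha <= N -> exists2 C : R, 0 <= C &
  forall (phi : V -> R) (F : R) (E : set V) lambda,
  measurable_fun B phi -> (forall z, 0 <= phi z) ->
  (\int[L]_(w in B) (phi w)%:E = F%:E)%E ->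
  measurable E -> E `<=` B -> 0 < lambda ->
  (forall z, E z ->
    (lambda%:E < \int[L]_(w in B) (phi w * qdist w z `^ (- alpha))%:E)%E) ->
  lambda * vol E `^ (alpha / N) <= C * F.
Proof.
move=> al; have [C C0 HC] := weak_type_truncated al; have /andP[al0 _] := al.
exists C => // phi F E lambda mphi phi0 phiF mE EB l0 EU.
have be0 : 0 < alpha / N by rewrite divr_gt0.
pose G k := E `&` [set z | k.+1%:R^-1 <= defect z].
have mG k : measurable (G k).
  by apply: measurableI => //; apply: measurable_ge; exact: measurable_defect.
have GB k : G k `<=` B by move=> z [/EB].
have EG : \bigcup_k G k = E.
  apply/seteqP; split => [z [k _ []]//|z Ez].
  have /unit_ballE z0 := EB _ Ez.
  exists (Num.bound (defect z)^-1) => //; split => //=.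
  rewrite invf_ple ?posrE//; apply: le_trans (ltW (archi_boundP _)) _.
    by rewrite invr_ge0 ltW.
  by rewrite ler_nat.
have F0 : 0 <= F by rewrite -lee_fin -phiF integral_ge0// => z _; rewrite lee_fin.
pose D := (C * F / lambda) `^ (alpha / N)^-1.
have D0 : 0 <= C * F / lambda by rewrite divr_ge0 ?mulr_ge0// ltW.
have GD k : vol (G k) <= D.
  have := HC phi F (G k) lambda k.+1%:R^-1 mphi phi0 phiF (mG k) (GB k) l0.
  rewrite invr_gt0 ltr0Sn => /(_ isT) H.
  have {}H : lambda * vol (G k) `^ (alpha / N) <= C * F.
    by apply: H => z []// Ez _; exact: EU.
  rewrite -[leLHS]powRr1 ?vol_ge0// -(divff (lt0r_neq0 be0)) powRrM.
  apply: ge0_ler_powR; rewrite ?nnegrE ?powR_ge0 ?invr_ge0 ?(ltW be0)//.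
  by rewrite ler_pdivlMr// mulrC.
have ED : vol E <= D.
  rewrite -lee_fin volK// -EG.
  have H : (L \o G) x @[x --> \oo] --> L (\bigcup_k G k).
    apply: nondecreasing_cvg_mu => //; first by rewrite EG.
    move=> a b ab; apply/subsetPset => z [Ez /= az]; split => //=.
    apply: le_trans az; rewrite lef_pV2 ?posrE// ler_nat ltnS//.
  rewrite -(cvg_lim _ H)//; apply: lime_le; first exact: cvgP H.
  by apply: nearW => k /=; rewrite -volK// lee_fin.
rewrite [leLHS]mulrC -ler_pdivlMr//.
have <- : D `^ (alpha / N) = C * F / lambda.
  by rewrite /D -powRrM mulVf ?powRr1// lt0r_neq0.
by apply: ge0_ler_powR; rewrite ?nnegrE ?vol_ge0 ?powR_ge0// ltW.
Qed.

End discretization.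

(** * Measurability of the operators *)

Section complex_power_measurability.
Variable R : realType.

Lemma measurable_acos_div dT (T : measurableType dT) (f g : T -> R) :
  measurable_fun setT f -> measurable_fun setT g ->
  (forall x, -1 <= f x * g x <= 1) ->
  measurable_fun setT (fun x => acos (f x * g x)).
Proof.
move=> mf mg fg1.
(* Continuity of [acos] is used on the open interval only; the endpoint values are acos 1 = 0 and
   acos (-1) = pi. *)
pose ac (y : R) := if -1 < y then if y < 1 then acos y else 0 else pi.
have -> : (fun x => acos (f x * g x)) = ac \o (fun x => f x * g x).
  apply/funext => x /=; rewrite /ac; have /andP[] := fg1 x.
  rewrite le_eqVlt => /orP[/eqP<-|->]; first by rewrite ltxx acosN1.
  by rewrite le_eqVlt => /orP[/eqP->|->//]; rewrite ltxx acos1.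
apply: measurableT_comp; last exact: measurable_funM.
have mlt1 : measurable_fun setT (fun y : R => y < 1) by exact: measurable_fun_ltr.
have mltN1 : measurable_fun setT (fun y : R => -1 < y) by exact: measurable_fun_ltr.
apply: measurable_fun_if => //.
apply: measurable_fun_if => //.
- by apply: mltN1 => //.
- exact: measurable_funTS.
rewrite (_ : _ `&` _ = `]-1, 1[%classic); last first.
  rewrite setTI; apply/seteqP; split => y /=; first by case=> /= h1 h2; rewrite in_itv/= h1 h2.
  by rewrite in_itv/= => /andP[].
apply: open_continuous_measurable_fun; first exact: interval_open.
by move=> y; rewrite inE/= in_itv/= => /continuous_acos.
Qed.

Lemma measurable_invr dT (T : measurableType dT) (f : T -> R) :
  measurable_fun setT f -> (forall x, 0 <= f x) ->
  measurable_fun setT (fun x => (f x)^-1).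
Proof.
move=> mf f0; rewrite (_ : (fun _ => _) = (fun y : R => y `^ (-1)) \o f).
  exact: (measurableT_comp (measurable_powR _)).
by apply/funext => x /=; rewrite powR_inv1.
Qed.

Lemma cmod_cexp (u : R[i]) : cmod (cexp u) = expR (complex.Re u).
Proof.
apply/eqP; rewrite -(eqrXn2 (ltn0Sn 1)) ?cmod_ge0 ?expR_ge0//.
by rewrite sqr_cmod/= !exprMn -mulrDr cos2Dsin2 mulr1.
Qed.

(** The exponent is real, so the argument contributes only a phase. This is what puts both operators
    under the same positive kernel. *)
Lemma cmod_cpow (x : R[i]) (a : R) : x != 0 -> cmod (cpow x a) = cmod x `^ a.
Proof.
move=> x0; rewrite cmod_cexp /powR cmod_eq0 (negbTE x0).
by rewrite /clog/= mul0r subr0.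
Qed.

Lemma ReM (x y : R[i]) : complex.Re (x * y) =
  complex.Re x * complex.Re y - complex.Im x * complex.Im y.
Proof. by case: x; case: y. Qed.

Lemma ImM (x y : R[i]) : complex.Im (x * y) =
  complex.Re x * complex.Im y + complex.Im x * complex.Re y.
Proof. by case: x; case: y. Qed.

Context dT (T : measurableType dT).
Implicit Types f g : T -> R[i].

Lemma measurable_cmul f g : measurable_fun setT f -> measurable_fun setT g ->
  measurable_fun setT (fun x => f x * g x).
Proof.
move=> mf mg.
have rf := measurableT_comp (@measurable_Re R) mf.
have jf := measurableT_comp (@measurable_Im R) mf.
have rg := measurableT_comp (@measurable_Re R) mg.
have jg := measurableT_comp (@measurable_Im R) mg.
apply: measurable_ReIm.
- rewrite (_ : _ \o _ = fun x => complex.Re (f x) * complex.Re (g x) -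
      complex.Im (f x) * complex.Im (g x)).
    exact: (measurable_funB (measurable_funM rf rg) (measurable_funM jf jg)).
  by apply/funext => x /=; rewrite ReM.
- rewrite (_ : _ \o _ = fun x => complex.Re (f x) * complex.Im (g x) +
      complex.Im (f x) * complex.Re (g x)).
    exact: (measurable_funD (measurable_funM rf jg) (measurable_funM jf rg)).
  by apply/funext => x /=; rewrite ImM.
Qed.

Lemma measurable_cinv f : measurable_fun setT f ->
  measurable_fun setT (fun x => (f x)^-1).
Proof.
move=> mf.
have rf := measurableT_comp (@measurable_Re R) mf.
have jf := measurableT_comp (@measurable_Im R) mf.
have m2 : measurable_fun setT
    (fun x => (complex.Re (f x) ^+ 2 + complex.Im (f x) ^+ 2)^-1).
  apply: measurable_invr; last by move=> x; rewrite addr_ge0 ?sqr_ge0.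
  exact: (measurable_funD (measurable_funX 2 rf) (measurable_funX 2 jf)).
apply: measurable_ReIm.
- rewrite (_ : _ \o _ = fun x => complex.Re (f x) *
      (complex.Re (f x) ^+ 2 + complex.Im (f x) ^+ 2)^-1).
    exact: (measurable_funM rf m2).
  by apply/funext => x /=; case: (f x).
- rewrite (_ : _ \o _ = fun x => 0 - complex.Im (f x) *
      (complex.Re (f x) ^+ 2 + complex.Im (f x) ^+ 2)^-1).
    by apply: measurable_funB => //; exact: (measurable_funM jf m2).
  by apply/funext => x /=; rewrite sub0r; case: (f x).
Qed.

Lemma measurable_carg f : measurable_fun setT f ->
  measurable_fun setT (fun x => carg (f x)).
Proof.
move=> mf.
have rf := measurableT_comp (@measurable_Re R) mf.
have jf := measurableT_comp (@measurable_Im R) mf.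
have nf := measurableT_comp (@measurable_cmod R) mf.
have ma : measurable_fun setT (fun x => acos (complex.Re (f x) / cmod (f x))).
  apply: (measurable_acos_div rf).
    by apply: (measurable_invr nf) => x; exact: cmod_ge0.
  move=> x /=; rewrite -ler_norml normrM.
  have [->|f0] := eqVneq (cmod (f x)) 0; first by rewrite invr0 normr0 mulr0.
  have fp : 0 < cmod (f x) by rewrite lt_def f0 cmod_ge0.
  by rewrite normfV (gtr0_norm fp) ler_pdivrMr// mul1r Re_le_cmod.
apply: measurable_fun_ifT => //.
- exact: measurable_fun_ler.
- by apply: measurableT_comp.
Qed.

Lemma measurable_cpow f (a : R) : measurable_fun setT f ->
  measurable_fun setT (fun x => cpow (f x) a).
Proof.
move=> mf; have nf := measurableT_comp (@measurable_cmod R) mf.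
have ml : measurable_fun setT (fun x => expR (a * ln (cmod (f x)))).
  apply: measurableT_comp => //; apply: measurable_funM => //.
  exact: (measurableT_comp (@measurable_ln R)).
have mc : measurable_fun setT (fun x => a * carg (f x)).
  by apply: measurable_funM => //; exact: measurable_carg.
apply: measurable_ReIm.
- rewrite (_ : _ \o _ = fun x => expR (a * ln (cmod (f x))) * cos (a * carg (f x))).
    apply: (measurable_funM ml); apply: (measurableT_comp _ mc).
    exact: continuous_measurable_fun (@continuous_cos R).
  by apply/funext => x /=; rewrite !mul0r subr0 addr0.
- rewrite (_ : _ \o _ = fun x => expR (a * ln (cmod (f x))) * sin (a * carg (f x))).
    apply: (measurable_funM ml); apply: (measurableT_comp _ mc).
    exact: continuous_measurable_fun (@continuous_sin R).
  by apply/funext => x /=; rewrite !mul0r subr0 addr0.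
Qed.

End complex_power_measurability.

(** * The integral operators *)

Section integral_operators.
Variables (R : realType) (n : nat).
Notation V := (n.+1.-tuple R[i]).
Notation B := (unit_ball R n.+1).
Notation L := (lebesgue_Cd R n.+1).
Notation N := (n.+2%:R : R).
Notation c0 := ((fine (L B))^-1).

Let mB : measurable B. Proof. exact: measurable_unit_ball. Qed.

Lemma ge0_integral_dv (f : V -> \bar R) : measurable_fun B f ->
  (forall z, 0 <= f z)%E ->
  (\int[dv R n.+1]_(z in B) f z = c0%:E * \int[L]_(z in B) f z)%E.
Proof. by move=> mf f0; rewrite /dv ge0_integral_mscale. Qed.

Lemma volume_inv_gt0 : 0 < c0.
Proof.
rewrite invr_gt0 fine_gt0// lebesgue_Cd_unit_ball_gt0/=.
by have := lebesgue_Cd_unit_ball_fin_num R n.+1; rewrite ge0_fin_numE.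
Qed.

(** Tonelli's theorem is applied to [L], which carries the sigma-finite structure, and the result is
    rescaled to [dv]. *)
Lemma measurable_ge0_integral_dv (H : V * V -> \bar R) : measurable_fun setT H ->
  (forall p, 0 <= H p)%E ->
  measurable_fun setT (fun z => \int[dv R n.+1]_(w in B) H (z, w))%E.
Proof.
move=> mH H0.
have mHz z : measurable_fun setT (fun w => H (z, w)).
  exact: (measurableT_comp mH (pair1_measurable z)).
have mSB : measurable (setT `*` B : set (V * V)) by exact: measurableX.
pose HB := H \_ (setT `*` B).
have mHB : measurable_fun setT HB.
  by apply/(measurable_restrictT _ _).1 => //; exact: measurable_funTS.
have HB0 p : (0 <= HB p)%E by rewrite /HB patchE; case: ifP.
rewrite (_ : (fun z => _) = fun z => (c0%:E * fubini_F L HB z)%E).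
  by apply: emeasurable_funM => //; exact: measurable_fun_fubini_tonelli_F.
apply/funext => z; rewrite ge0_integral_dv//; last exact: measurable_funTS.
congr (_ * _)%E; rewrite integral_mkcond /fubini_F; apply: eq_integral => w _.
by rewrite /HB !patchE in_setX in_setT.
Qed.

Lemma measurable_Rintegral_dv (g : V * V -> R) : measurable_fun setT g ->
  measurable_fun setT (fun z => \int[dv R n.+1]_(w in B) g (z, w))%R.
Proof.
move=> mg; have mG : measurable_fun setT (EFin \o g) by exact/measurable_EFinP.
rewrite (_ : (fun z => _) = fine \o (fun z =>
  (\int[dv R n.+1]_(w in B) (EFin \o g)^\+ (z, w) -
   \int[dv R n.+1]_(w in B) (EFin \o g)^\- (z, w))%E)).
  apply: measurableT_comp; first exact: fine_measurable.
  apply: emeasurable_funB; apply: measurable_ge0_integral_dv => //.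
  - exact: measurable_funepos.
  - exact: measurable_funeneg.
apply/funext => z; congr fine; rewrite integralE.
by congr (_ - _)%E; apply: eq_integral => w _; rewrite ?funeposE ?funenegE.
Qed.

(** Real and imaginary parts are bounded separately, which costs the factor 2. A real integral whose
    extended value is infinite is 0 by convention, so the bound survives divergence. *)
Lemma cmod_cintegral_le (g : V -> R[i]) : measurable_fun setT g ->
  ((cmod (cintegral g))%:E <=
   2%:E * \int[dv R n.+1]_(w in B) (cmod (g w))%:E)%E.
Proof.
move=> mg.
have mc : measurable_fun setT (fun w => (cmod (g w))%:E).
  by apply/measurable_EFinP; exact: (measurableT_comp (@measurable_cmod R)).
have key (h : V -> R) : measurable_fun setT h -> (forall w, `|h w| <= cmod (g w)) ->
    (`|\int[dv R n.+1]_(w in B) h w|%:E <= \int[dv R n.+1]_(w in B) (cmod (g w))%:E)%E.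
  move=> mh hg; have mhE : measurable_fun B (EFin \o h).
    by apply: measurable_funTS; exact/measurable_EFinP.
  apply: (@le_trans _ _ `|\int[dv R n.+1]_(w in B) (h w)%:E|%E).
    rewrite /Rintegral; case: (\int[_]_(w in B) _)%E => [r||] //=.
    - by rewrite normr0 leey.
    - by rewrite normr0 leey.
  apply: le_trans (le_abse_integral _ mB mhE) _.
  apply: ge0_le_integral => //.
  - exact: measurableT_comp.
  - exact: measurable_funTS.
  - by move=> w _; rewrite lee_fin.
apply: (@le_trans _ _ (`|\int[dv R n.+1]_(w in B) complex.Re (g w)|%:E +
    `|\int[dv R n.+1]_(w in B) complex.Im (g w)|%:E)%E).
  by rewrite -EFinD lee_fin; exact: cmod_le_ReIm.
have -> : (2%:E = 1 + 1 :> \bar R)%E by rewrite -EFinD.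
rewrite ge0_muleDl// mul1e; apply: leeD; apply: key.
- exact: (measurableT_comp (@measurable_Re R)).
- by move=> w; exact: Re_le_cmod.
- exact: (measurableT_comp (@measurable_Im R)).
- by move=> w; exact: Im_le_cmod.
Qed.

(** Only the modulus of the kernel enters, and the constant is chosen before the kernel, so one
    constant serves both operators. *)
Lemma weak_type_operator (alpha : R) : 0 < alpha <= N -> exists C : R,
  forall k : V -> V -> R[i],
  measurable_fun setT (fun p : V * V => k p.1 p.2) ->
  (forall z w, B z -> B w -> cmod (k z w) = qdist z w `^ (- alpha)) ->
  bounded_L1_weak (N / alpha) (fun f z => cintegral (fun w => f w * k z w)) C.
Proof.
move=> al; have [C C0 HC] := weak_type_integral al; have /andP[al0 _] := al.
have c_gt0 := volume_inv_gt0.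
exists (2 * C * c0 `^ (alpha / N)) => k mk kE f [mf ff].
set T := fun z : V => _; set D := 2 * C * _.
(* [f] is measurable on the ball only; its extension by 0 is measurable everywhere and has the same
   integrals. *)
pose ft := f \_ B.
have mft : measurable_fun setT ft.
  by apply/(measurable_restrictT _ _).1.
have ftE z : B z -> ft z = f z by move=> Bz; rewrite /ft patchE ifT// inE.
have TE z : T z = cintegral (fun w => ft w * k z w).
  by congr Complex; apply: eq_Rintegral => w /set_mem Bw; rewrite ftE.
have mprod : measurable_fun setT (fun p : V * V => ft p.2 * k p.1 p.2).
  exact: (measurable_cmul (measurableT_comp mft measurable_snd) mk).
have mT : measurable_fun setT T.
  rewrite (_ : T = fun z => cintegral (fun w => ft w * k z w)); last exact/funext.
  apply: measurable_ReIm.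
  - exact: (measurable_Rintegral_dv (measurableT_comp (@measurable_Re R) mprod)).
  - exact: (measurable_Rintegral_dv (measurableT_comp (@measurable_Im R) mprod)).
pose phi z := cmod (ft z).
have mphi : measurable_fun setT phi by exact: (measurableT_comp (@measurable_cmod R)).
have phi0 z : 0 <= phi z by exact: cmod_ge0.
have L1E : L1norm f = (c0%:E * \int[L]_(z in B) (phi z)%:E)%E.
  rewrite -ge0_integral_dv//; last first.
    by apply: measurable_funTS; exact/measurable_EFinP.
  by apply: eq_integral => z /set_mem Bz; rewrite /phi ftE.
have phi_fin : (\int[L]_(z in B) (phi z)%:E)%E \is a fin_num.
  rewrite ge0_fin_numE; last by apply: integral_ge0 => z _; rewrite lee_fin.
  rewrite ltey; apply/eqP => E; move: ff; rewrite L1E E gt0_muley ?lte_fin//.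
pose F := fine (\int[L]_(z in B) (phi z)%:E)%E.
have FE : (\int[L]_(w in B) (phi w)%:E = F%:E)%E by rewrite /F fineK.
have weak : (weak_norm (N / alpha) T <= D%:E * L1norm f)%E.
  apply: ge_ereal_sup => _ [lambda /= l0 <-].
  pose E := B `&` [set z | lambda < cmod (T z)].
  have mE : measurable E.
    apply: measurableI => //.
    rewrite (_ : [set _ | _] = [set z | - cmod (T z) < - lambda]); last first.
      by apply/seteqP; split => z /=; rewrite ltrN2.
    apply: measurable_lt; apply: measurableT_comp => //.
    exact: (measurableT_comp (@measurable_cmod R)).
  have EB : E `<=` B by move=> z [].
  have dE : distr_fun T lambda = (c0 * vol E)%:E.
    by rewrite EFinM volK.
  rewrite dE poweR_EFin invf_div powRM ?vol_ge0 ?(ltW c_gt0)// L1E FE -!EFinM lee_fin.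
  (* The level is divided by the factor 2 of [cmod_cintegral_le] and by the normalization c0 of
     [dv]. The latter returns through [L1norm]; the power of c0 in the constant comes from
     [distr_fun]. *)
  have l2 : 0 < lambda / (2 * c0) by rewrite divr_gt0// mulr_gt0.
  have H : lambda / (2 * c0) * vol E `^ (alpha / N) <= C * F.
    apply: (HC phi F E) => //; first exact: measurable_funTS.
    move=> z [Bz /= Tz].
    have mw : measurable_fun setT (fun w => ft w * k z w).
      exact: (measurableT_comp mprod (pair1_measurable z)).
    have := cmod_cintegral_le mw; rewrite -TE => H.
    have mI : measurable_fun setT (fun w => (phi w * qdist w z `^ (- alpha))%:E).
      apply/measurable_EFinP; apply: measurable_funM => //.
      have := @measurable_kernel R n z (- alpha).
      by congr measurable_fun; apply/funext => u; rewrite qdistC.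
    have IE : (\int[dv R n.+1]_(w in B) (cmod (ft w * k z w))%:E =
        c0%:E * \int[L]_(w in B) (phi w * qdist w z `^ (- alpha))%:E)%E.
      rewrite -ge0_integral_dv//; last 2 first.
      - exact: measurable_funTS.
      - by move=> w; rewrite lee_fin mulr_ge0 ?powR_ge0.
      by apply: eq_integral => w /set_mem Bw; rewrite cmodM kE// qdistC.
    move: H; rewrite IE.
    have : (0 <= \int[L]_(w in B) (phi w * qdist w z `^ (- alpha))%:E)%E.
      by apply: integral_ge0 => w _; rewrite lee_fin mulr_ge0 ?powR_ge0.
    case: (\int[L]_(w in B) _)%E => [r|_ _|//]; last by rewrite ltry.
    move=> _; rewrite -!EFinM lee_fin lte_fin ltr_pdivrMr ?mulr_gt0// => H.
    by apply: lt_le_trans Tz (le_trans H _); rewrite mulrA mulrC.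
  move: H; rewrite mulrAC ler_pdivrMr ?mulr_gt0// => H.
  rewrite /D [leRHS](_ : _ = c0 `^ (alpha / N) * (C * F * (2 * c0))); last by ring.
  by rewrite mulrCA; apply: ler_wpM2l => //; exact: powR_ge0.
split=> //; split; first exact: measurable_funTS.
apply: le_lt_trans weak _; rewrite L1E FE -!EFinM ltry//.
Qed.

End integral_operators.

Theorem corollary4p7 (R : realType) (d : nat) (alpha : R)
    (hd : (1 <= d)%N) (halpha : 0 < alpha <= (d + 1)%:R) :
  exists C : R,
    bounded_L1_weak ((d + 1)%:R / alpha) (Kop d alpha) C /\
    bounded_L1_weak ((d + 1)%:R / alpha) (Kop_plus d alpha) C.
Proof.
case: d hd halpha => // n _; rewrite addn1 => al.
have [C HC] := weak_type_operator al; exists C; split.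
- apply: (HC (fun z w => (cpow (1 - cdot z w) alpha)^-1)).
    apply: measurable_cinv; apply: measurable_cpow; exact: measurable_onem_cdot.
  move=> z w Bz Bw; rewrite cmodV cmod_cpow ?powRN//.
  by rewrite -cmod_eq0 gt_eqF//; exact: (qdist_gt0 Bz Bw).
- apply: (HC (fun z w => (Complex (cmod (1 - cdot z w) `^ alpha) 0)^-1)).
    apply: measurable_cinv; apply: measurable_ReIm.
      apply: (measurableT_comp (measurable_powR _)).
      exact: measurable_qdist_pair.
    exact: measurable_cst.
  by move=> z w Bz Bw; rewrite cmodV cmod_real ger0_norm ?powR_ge0// powRN.
Qed.
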